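(* Let $z:[0,\infty)\to[0,\infty]$ be nonincreasing and lower semi-continuous, set $c(\phi)=z(\phi)\phi$ (with $c(0)=0$), and let $\tau=\tau^z$, where $\tau^z(w)=\inf\{F^c[\psi]\mid\psi:\mathbb{R}\to[0,\infty),\ \int_{\mathbb{R}}\psi\,dy=w\}$. Let $g=(z^{-1}(\cdot))^{3/2}$ and $r(s)=\frac{2\sqrt2}{3\sqrt{-s}}$ for $s<0$, $r(s)=0$ otherwise. Then $$[-\tau(-\cdot)]^\ast(t)=[g*r](t)$$ holds for all $t\in\{\tau'(w)\mid w\geq0,\ \tau\text{ is differentiable at }w\}$.
   Context: For $c:[0,\infty)\to[0,\infty)$ and $\psi:\mathbb{R}\to\mathbb{R}$ (with locally integrable weak derivative; otherwise the energy is $+\infty$), $F^c[\psi]=\int_{\mathbb{R}}\frac12|\psi'(y)|^2+c(|\psi(y)|)\,dy$. The generalized inverse of a nonincreasing lower semi-continuous $f:[0,\infty)\to[0,\infty]$ is $f^{-1}(x)=\inf\{y\in[0,\infty)\mid f(y)\leq x\}$ with $\inf\emptyset=\infty$. $[-\tau(-\cdot)]^\ast$ is the Legendre–Fenchel conjugate of $s\mapsto-\tau(-s)$, where $\tau$ is extended by $-\infty$ on $(-\infty,0)$; explicitly $[-\tau(-\cdot)]^\ast(t)=\sup_{w\geq0}(\tau(w)-tw)$. Convolution: $[g*r](t)=\int_{\mathbb{R}}g(s)r(t-s)\,ds=\int_t^\infty\frac{2\sqrt2\,g(s)}{3\sqrt{s-t}}\,ds$. At $w=0$, $\tau'(0)$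 denotes the right derivative. *)

(* Defs.v *)
From HB Require Import structures.
From mathcomp Require Import all_boot all_order all_algebra.
From mathcomp Require Import all_classical all_reals all_analysis.
Set Implicit Arguments. Unset Strict Implicit. Unset Printing Implicit Defensive.
Import Order.TTheory GRing.Theory Num.Theory.
Import numFieldNormedType.Exports.
Local Open Scope classical_set_scope.
Local Open Scope ring_scope.

Section Defs.
Variable R : realType.
Local Notation mu := (@lebesgue_measure R).

Definition test_fun (phi : R -> R) : Prop :=
  (forall (n : nat) (x : R), derivable (derive1n n phi) x 1) /\
  (exists M : R, forall x : R, M < `|x| -> phi x = 0).

Definition weak_deriv (psi dpsi : R -> R) : Prop :=
  locally_integrable setT psi /\ locally_integrable setT dpsi /\
  forall phi : R -> R, test_fun phi ->
    (\int[mu]_(y in setT) (psi y * derive1 phi y)%:E =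
     - \int[mu]_(y in setT) (dpsi y * phi y)%:E)%E.

Definition c_of (z : R -> \bar R) (p : R) : \bar R :=
  if p == 0 then 0%E else (z p * p%:E)%E.

(* F^c[psi] = int 1/2 |psi'|^2 + c(|psi|), := +oo if no loc. integrable weak derivative *)
Definition energy (c : R -> \bar R) (psi : R -> R) : \bar R :=
  ereal_inf [set (\int[mu]_(y in setT) ((2^-1 * dpsi y ^+ 2)%:E + c (`|psi y|)%R))%E
            | dpsi in [set dpsi | weak_deriv psi dpsi]].

Definition tau_z (z : R -> \bar R) (w : R) : \bar R :=
  ereal_inf [set energy (c_of z) psi | psi in
     [set psi : R -> R | (forall y, 0 <= psi y) /\
                         (\int[mu]_(y in setT) (psi y)%:E = w%:E)%E]].

(* generalized inverse f^{-1}(x) = inf { y >= 0 | f y <= x }, inf of empty = +oo *)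
Definition gen_inv (f : R -> \bar R) (x : R) : \bar R :=
  ereal_inf [set y%:E | y in [set y : R | 0 <= y /\ (f y <= x%:E)%E]].

Definition g_of (z : R -> \bar R) (s : R) : \bar R := poweR (gen_inv z s) (3 / 2).

Definition r_ker (s : R) : R :=
  if s < 0 then 2 * Num.sqrt 2 / (3 * Num.sqrt (- s)) else 0.

Definition convol (g : R -> \bar R) (r : R -> R) (t : R) : \bar R :=
  (\int[mu]_(s in setT) (g s * (r (t - s))%:E))%E.

(* [-tau(-.)]^*(t) = sup_{w >= 0} (tau(w) - t w) *)
Definition conj_tau (tau : R -> \bar R) (t : R) : \bar R :=
  ereal_sup [set (tau w - (t * w)%:E)%E | w in [set w : R | 0 <= w]].

(* tau (a function on [0,oo)) is differentiable at w >= 0 with derivative d;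
   at w = 0 this is the right derivative (only h with w + h >= 0 are used). *)
Definition deriv_at (tau : R -> \bar R) (w d : R) : Prop :=
  0 <= w /\
  (exists e : R, 0 < e /\ forall h : R, `|h| < e -> 0 <= w + h -> tau (w + h) \is a fin_num) /\
  (forall eps : R, 0 < eps -> exists delta : R, 0 < delta /\
     forall h : R, 0 < `|h| < delta -> 0 <= w + h ->
       `|(fine (tau (w + h)) - fine (tau w)) / h - d| < eps).

Definition nonincreasing0 (z : R -> \bar R) : Prop :=
  forall x y : R, 0 <= x -> x <= y -> (z y <= z x)%E.

Definition lsc0 (z : R -> \bar R) : Prop :=
  forall (x : R) (a : \bar R), 0 <= x -> (a < z x)%E ->
    exists e : R, 0 < e /\ forall y : R, 0 <= y -> `|y - x| < e -> (a < z y)%E.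

End Defs.

(* Main.v *)
Require Import Defs.
From HB Require Import structures.
From mathcomp Require Import all_boot all_order all_algebra.
From mathcomp Require Import all_classical all_reals all_analysis.
From mathcomp Require Import measurable_realfun.
From mathcomp Require Import ring lra.
Set Implicit Arguments.
Unset Strict Implicit.
Unset Printing Implicit Defensive.
Import Order.TTheory GRing.Theory Num.Theory.
Import numFieldNormedType.Exports.
Local Open Scope classical_set_scope.
Local Open Scope ring_scope.

(* Write G(t) for the convolution. Two estimates say that the functions
   w |-> G(s) + s w are, up to arbitrarily small errors, upper tangents of tau.
   (1) If tau is finite at some positive mass, then tau(w) <= G(t) + t w for all t
   and w >= 0. The competitor is a symmetric profile that climbs with equipartition
   slope psi'^2 / 2 = (z(psi) - t) psi up to the height where z reaches t, and then
   stays on a plateau long enough to have mass w; its cost in excess of t w is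
   2 int sqrt(2 (z(h) - t) h) dh = G(t).
   (2) Every profile of mass w > 0 and finite energy E satisfies G(s) + s w <= E with
   s = z(sup psi), by Young's inequality on both sides of a maximum.
   If tau'(w0) = t, then (1) gives [-tau(-.)]^*(t) <= G(t). Applying (2) to
   near-minimisers of mass slightly above w0 gives multipliers s_n -> t with
   limsup G(s_n) <= tau(w0) - t w0, and Fatou's lemma passes to G(t). Both estimates
   are proved through step-function approximations of g. *)

(** As [z] may jump and may take the value [+oo], neither the equipartition equation nor the
    substitution behind [2 int sqrt(2 (z(h) - t) h) dh = G(t)] is used literally. Both become sums
    over geometric levels of ratio [l]: since [sqrt h dh = 2/3 d(h^(3/2))], a band on which [z] is
    about [K] contributes [4/3 sqrt 2 sqrt(K - t)] times the increment of [h^(3/2)], and this is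
    what the kernel yields on one step of [g]. The discretisation loses a factor [l ^+ 4], and [l]
    tends to 1. Finitely many bands cannot start at height 0. Competitors therefore borrow a tail of
    small mass and energy from some profile of finite energy; this is how finiteness of tau at a
    positive mass enters (1). The infimum in tau runs over weakly differentiable profiles, but level
    crossings and gluing need continuous ones. Hence weak differentiability is first identified with
    being, up to a null set, a primitive of the weak derivative; explicit smooth bumps supply the
    test functions. *)

(** * Smooth bumps built from [exp(-1/x)] *)

Section FlatFunctions.
Context {R : realType}.
Implicit Types (P Q : {poly R}) (x : R).

(* Functions of the form P(1/x) exp(-1/x) are closed under differentiation, which
   makes the bumps built from them smooth. *)
Definition flat P x : R := if 0 < x then P.[x^-1] * expR (- x^-1) else 0.

Lemma exprn_expRN_le (u : R) n : 0 <= u -> u ^+ n * expR (- u) <= n`!%:R.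
Proof.
move=> u0; rewrite expRN ler_pdivrMr ?expR_gt0//.
case: n => [|n]; first by rewrite expr0 fact0 mul1r -expR0 ler_expR.
have h := @expR_ge1Dxn _ u n u0.
have f0 : 0 < (n.+1)`!%:R :> R by rewrite ltr0n fact_gt0.
have : u ^+ n.+1 / (n.+1)`!%:R <= expR u by apply: le_trans h; rewrite lerDr.
by rewrite ler_pdivrMr// mulrC.
Qed.

(** With [u = 1/x], dividing by [x ^+ 2] raises each monomial to [u ^+ (i + 2)], and
    [u ^+ m * exp(-u) <= m!]. The quadratic decay makes the difference quotient at 0 vanish,
    whatever [P] is. *)
Lemma flat_bound P : exists2 C, 0 <= C & forall x, `|flat P x| <= C * x ^+ 2.
Proof.
pose C : R := \sum_(i < size P) `|P`_i| * (i.+2)`!%:R.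
have C0 : 0 <= C by apply: sumr_ge0 => i _; rewrite mulr_ge0// ler0n.
exists C => // x; rewrite /flat; case: ifPn => [x0|_]; last first.
  by rewrite normr0 mulr_ge0// sqr_ge0.
have u0 : 0 < x^-1 by rewrite invr_gt0.
rewrite -ler_pdivrMr ?exprn_gt0// -exprVn.
rewrite normrM (ger0_norm (expR_ge0 _)) horner_coef.
apply: (@le_trans _ _ ((\sum_(i < size P) `|P`_i| * x^-1 ^+ i) *
    expR (- x^-1) * x^-1 ^+ 2)).
  rewrite ler_wpM2r ?sqr_ge0// ler_wpM2r ?expR_ge0//.
  apply: (le_trans (ler_norm_sum _ _ _)); apply: ler_sum => i _.
  by rewrite normrM (ger0_norm (exprn_ge0 _ (ltW u0))).
rewrite -mulrA mulr_suml; apply: ler_sum => i _.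
rewrite -mulrA ler_wpM2l//.
rewrite [expR _ * _]mulrC mulrA -exprD addn2.
by apply: exprn_expRN_le; exact: ltW.
Qed.

(** Chain rule in [u = 1/x]: the [u]-derivative of [P(u) exp(-u)] is [(P' - P)(u) exp(-u)], and
    [du/dx = - u^2]. *)
Definition flat_deriv P : {poly R} := 'X^2 * (P - P^`()).

Lemma is_derive_flat P x : is_derive x 1 (flat P) (flat (flat_deriv P) x).
Proof.
have [x0|x0|->] := ltgtP x 0.
- rewrite {2}/flat ltNge (ltW x0)/=.
  apply: (@near_eq_is_derive _ _ _ (cst 0)).
  near=> y; rewrite /flat ifF//; apply/negbTE; rewrite -leNgt ltW//.
  by near: y; exact: lt_nbhsl.
- rewrite {2}/flat x0.
  apply: (@near_eq_is_derive _ _ _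
      ((horner P \o (fun y : R => y^-1)) * (expR \o (fun y => - y^-1)))).
    near=> y; rewrite /flat ifT//.
    by near: y; exact: lt_nbhsr.
  have dV : is_derive x 1 (fun y : R => y^-1) (- x ^- 2 *: (1 : R)).
    by apply: (@is_deriveV _ id) => //; rewrite gt_eqF.
  have d1 := @is_derive1_comp _ _ _ _ _ _ (is_derive_poly P x^-1) dV.
  have dN : is_derive x 1 (fun y : R => - y^-1) (x ^- 2).
    by apply: is_derive_eq (is_deriveN dV) _; rewrite /GRing.scale/= mulr1 opprK.
  have d2 := @is_derive1_comp _ _ (fun y => - y^-1) _ _ _
    (is_derive_expR (- x^-1)) dN.
  apply: is_derive_eq (is_deriveM d1 d2) _.
  rewrite /= /flat_deriv !hornerE /= /GRing.scale/= -exprVn; ring.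
- rewrite {2}/flat ltxx.
  have [C C0 HC] := flat_bound P.
  have h : (h^-1 *: (flat P (h *: (1:R) + 0) - flat P 0)) @[h --> 0^'] --> (0 : R).
    apply/cvgr0Pnorm_lt => eps e0; near=> h.
    have h0 : h != 0 by near: h; exact: nbhs_dnbhs_neq.
    rewrite {2}/flat ltxx subr0 addr0 /GRing.scale/= mulr1 normrM normfV.
    rewrite mulrC ltr_pdivrMr ?normr_gt0//.
    apply: le_lt_trans (HC h) _.
    rewrite -(real_normK (num_real h)) expr2 mulrA ltr_pM2r ?normr_gt0//.
    have : `|h| < eps / (C + 1).
      near: h; apply: dnbhs0_lt.
      by rewrite divr_gt0// ltr_pwDr.
    rewrite ltr_pdivlMr ?ltr_pwDr//.
    have := normr_ge0 h; nra.
  by apply: DeriveDef; [apply/cvg_ex; exists 0; exact: h|exact: cvg_lim h].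
Unshelve. all: by end_near. Qed.

Lemma flat_ge0_le1 x : 0 <= flat 1 x <= 1.
Proof.
rewrite /flat; case: ifPn => [x0|_]; last by rewrite lexx ler01.
by rewrite hornerE mul1r expR_ge0 -expR0 ler_expR oppr_le0 invr_ge0 ltW.
Qed.

(** The generator is a product because a bump needs one flat factor for each end of its support.
    Sums and multiples close the class under the product rule, so differentiability of every order
    follows from a single induction. *)
Inductive bump_comb : (R -> R) -> Prop :=
| bump_comb_gen (P Q : {poly R}) (a b c d : R) :
    bump_comb (fun x => flat P (a * x + b) * flat Q (c * x + d))
| bump_combZ (k : R) f : bump_comb f -> bump_comb (fun x => k * f x)
| bump_combD f g : bump_comb f -> bump_comb g -> bump_comb (fun x => f x + g x).

Lemma bump_comb_derive f : bump_comb f ->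
  exists2 g, bump_comb g & forall x, is_derive x 1 f (g x).
Proof.
elim=> {f} [P Q a b c d|k f _ [g bg dg]|f g _ [f' bf df] _ [g' bg dg]].
- exists (fun x => a * (flat (flat_deriv P) (a * x + b) * flat Q (c * x + d)) +
    c * (flat P (a * x + b) * flat (flat_deriv Q) (c * x + d))).
    by apply: bump_combD; apply: bump_combZ; exact: bump_comb_gen.
  have aff (k l x : R) : is_derive x 1 (fun y : R => k * y + l) k.
    have := is_deriveD (is_deriveZ k (is_derive_id x (1:R))) (is_derive_cst l x (1:R)).
    by move=> h; apply: is_derive_eq h _; rewrite /GRing.scale/= mulr1 addr0.
  move=> x.
  have d1 := @is_derive1_comp _ _ (fun y => a * y + b) _ _ _
    (is_derive_flat P (a * x + b)) (aff a b x).
  have d2 := @is_derive1_comp _ _ (fun y => c * y + d) _ _ _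
    (is_derive_flat Q (c * x + d)) (aff c d x).
  by apply: is_derive_eq (is_deriveM d1 d2) _; rewrite /= /GRing.scale/=; ring.
- exists (fun x => k * g x); first exact: bump_combZ.
  by move=> x; exact: is_deriveZ (dg x).
- exists (fun x => f' x + g' x); first exact: bump_combD.
  by move=> x; exact: is_deriveD (df x) (dg x).
Qed.

Lemma bump_comb_derive1n f n : bump_comb f -> bump_comb (derive1n n f).
Proof.
move=> bf; elim: n => [|n /bump_comb_derive[g bg dg]]; first by rewrite derive1n0.
rewrite derive1nS (_ : derive1 _ = g)//; apply/funext => x.
by rewrite derive1E; apply: derive_val.
Qed.

Lemma bump_comb_derivable f n x : bump_comb f -> derivable (derive1n n f) x 1.
Proof.
by move=> /(@bump_comb_derive1n _ n)/bump_comb_derive[g _ /(_ x)[]].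
Qed.

Lemma bump_comb_continuous f : bump_comb f -> continuous f.
Proof.
move=> bf x; apply: differentiable_continuous; apply/derivable1_diffP.
by have := @bump_comb_derivable f 0 x bf; rewrite derive1n0.
Qed.

End FlatFunctions.

(** * Mollified steps and weak derivatives at Lebesgue points *)

Section SmoothStep.
Context {R : realType}.
Local Notation mu := (@lebesgue_measure R).

(** [Phi] is the normalised primitive of a bump on []a, a + e[]. The constant [C] is chosen before
    [a] and [e]: a bound [C / e] uniform in both lets [rho] be compared with plain averages over
    small balls. *)
Lemma smooth_step : exists2 C : R, 0 < C & forall a e : R, 0 < e ->
  exists Phi rho : R -> R,
    [/\ bump_comb rho, (forall x : R, is_derive x 1 Phi (rho x)),
        (forall x, 0 <= Phi x <= 1) &
     [/\ (forall x, x <= a -> Phi x = 0), (forall x, a + e <= x -> Phi x = 1),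
         (forall x, 0 <= rho x <= C / e), (forall x, ~~ (a < x < a + e) -> rho x = 0) &
         (\int[mu]_x (rho x)%:E = 1)%E]].
Proof.
(* On the middle third of [[a, a + e]] both rescaled arguments are at least [1/3], so each flat
   factor is at least [exp(-3)] and the bump has integral at least [k * e / 3]. As the bump is at
   most 1, normalising it gives the bound [3 / (k * e)]. *)
pose k : R := expR (- 3) * expR (- 3).
have k0 : 0 < k by rewrite mulr_gt0// expR_gt0.
exists (3 / k); first by rewrite divr_gt0.
move=> a e e0.
have ei : 0 < e^-1 by rewrite invr_gt0.
pose g x := flat 1 (e^-1 * x + (- a / e)) * flat 1 (- e^-1 * x + (a + e) / e).
have bg : bump_comb g by exact: bump_comb_gen.
have cg := bump_comb_continuous bg.
have mg : measurable_fun setT g by exact: continuous_measurable_fun.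
have g01 x : 0 <= g x <= 1.
  have /andP[u0 u1] := flat_ge0_le1 (e^-1 * x + (- a / e)).
  have /andP[v0 v1] := flat_ge0_le1 (- e^-1 * x + (a + e) / e).
  by rewrite mulr_ge0//= mulr_ile1.
have g_out x : ~~ (a < x < a + e) -> g x = 0.
  rewrite negb_and -!leNgt => /orP[xa|xa].
    rewrite /g {1}/flat ifF ?mul0r//; apply/negbTE; rewrite -leNgt.
    by rewrite mulNr mulrC -mulrBl pmulr_lle0// subr_le0.
  rewrite /g mulrC {1}/flat ifF ?mul0r//; apply/negbTE; rewrite -leNgt.
  by rewrite mulNr addrC mulrC -mulrBr pmulr_rle0// subr_le0.
have ig : mu.-integrable setT (EFin \o g).
  have -> : EFin \o g = (EFin \o g) \_ `[a, a + e].
    apply/funext => x; rewrite patchE; case: ifPn => //= xI.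
    rewrite g_out//; apply/negP => /andP[h1 h2]; move/negP: xI; apply.
    by rewrite inE/= in_itv/= !ltW.
  apply/(@integrable_mkcond _ _ _ mu `[a, a + e] (EFin \o g)) => //.
  apply: continuous_compact_integrable; first exact: segment_compact.
  exact: continuous_subspaceT.
have igS (A : set R) : measurable A -> mu.-integrable A (EFin \o g).
  by move=> mA; exact: integrableS ig.
pose c := \int[mu]_x g x.
have cE : (\int[mu]_x (g x)%:E = c%:E)%E.
  by rewrite /c /Rintegral fineK//; exact: integrable_fin_num ig.
have g0E x : (0 <= (g x)%:E)%E by rewrite lee_fin; case/andP: (g01 x).
have lowl (y : R) : a + e / 3 <= y -> 1 / 3 <= e^-1 * y + - a / e.
  rewrite (_ : e^-1 * y + - a / e = (y - a) / e); last by ring.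
  by rewrite ler_pdivlMr// => ?; lra.
have lowr (y : R) : y <= a + e / 3 + e / 3 -> 1 / 3 <= - e^-1 * y + (a + e) / e.
  rewrite (_ : - e^-1 * y + (a + e) / e = (a + e - y) / e); last by ring.
  by rewrite ler_pdivlMr// => ?; lra.
have cge : k * (e / 3) <= c.
  rewrite -lee_fin -cE.
  apply: (@le_trans _ _ (\int[mu]_(x in `[(a + e / 3)%R, (a + e / 3 + e / 3)%R])
      (g x)%:E)%E); last first.
    by apply: ge0_subset_integral => //; exact/measurable_EFinP.
  apply: (@le_trans _ _ (\int[mu]_(x in `[(a + e / 3)%R, (a + e / 3 + e / 3)%R]) (cst k%:E x))%E).
    rewrite integral_cst//= lebesgue_measure_itv/= lte_fin ltrDl divr_gt0//.
    by rewrite -EFinB -EFinM lee_fin addrAC subrr add0r.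
  apply: ge0_le_integral => //.
  - by move=> x _; rewrite lee_fin ltW.
  - by apply/measurable_EFinP; exact: measurable_funS mg.
  - move=> x /=; rewrite in_itv/= => /andP[x1 x2]; rewrite lee_fin /g.
    have h (y : R) : 1 / 3 <= y -> expR (- 3) <= flat 1 y.
      move=> hy; have y0 : 0 < y by apply: lt_le_trans hy; rewrite divr_gt0.
      rewrite /flat y0 hornerE mul1r ler_expR lerN2 -[leRHS]invrK lef_pV2 ?posrE ?invr_gt0//.
      by rewrite -div1r.
    apply: ler_pM; rewrite ?expR_ge0//; apply: h.
      by move: x1; exact: lowl.
    by move: x2; exact: lowr.
have c0 : 0 < c by apply: lt_le_trans cge; rewrite mulr_gt0// divr_gt0.
pose F x := \int[mu]_(t in `]-oo, x]) g t.
have FE x : (\int[mu]_(t in `]-oo, x]) (g t)%:E = (F x)%:E)%E.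
  by rewrite /F /Rintegral fineK//; apply: integrable_fin_num => //; exact: igS.
exists (fun x => c^-1 * F x), (fun x => c^-1 * g x); split; [|move=> x|move=> x|split].
- exact: bump_combZ.
- have xx1 : x < x + 1 by rewrite ltrDl.
  have H := @continuous_FTC1 _ g -oo%O x (x + 1) xx1 (igS _ (measurable_itv _)).
  have [|dF F'] := H _ (cg x); first by rewrite ltNyr.
  apply: is_deriveZ; apply: DeriveDef; first exact: dF.
  by rewrite -derive1E.
- have F0 : 0 <= F x by rewrite -lee_fin -FE integral_ge0.
  have Fc : F x <= c.
    rewrite -lee_fin -FE -cE; apply: ge0_subset_integral => //.
    exact/measurable_EFinP.
  by apply/andP; split; [rewrite mulr_ge0// invr_ge0 ltW|rewrite mulrC ler_pdivrMr// mul1r].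
- move=> x xa; rewrite (_ : F x = 0) ?mulr0//; apply: EFin_inj; rewrite -FE.
  apply: integral0_eq => y /=; rewrite in_itv/= => yx; rewrite g_out//.
  by rewrite negb_and -leNgt (le_trans yx xa).
- move=> x xa; rewrite (_ : F x = c) ?mulVf ?gt_eqF//; apply: EFin_inj; rewrite -FE -cE.
  rewrite integral_mkcond; apply: eq_integral => y _; rewrite patchE; case: ifPn => //=.
  move=> yx; rewrite g_out// negb_and -!leNgt orbC (le_trans xa)//.
  by move/negP: yx; rewrite inE/= in_itv/= => /negP; rewrite -ltNge => /ltW.
- move=> x; have /andP[gx0 gx1] := g01 x.
  apply/andP; split; first by rewrite mulr_ge0// invr_ge0 ltW.
  apply: (@le_trans _ _ c^-1); first by rewrite ler_piMr// invr_ge0 ltW.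
  have -> : 3 / k / e = (k * (e / 3))^-1 by field; rewrite !gt_eqF.
  by rewrite lef_pV2// posrE// mulr_gt0// divr_gt0.
- by move=> x xo; rewrite g_out ?mulr0.
- under eq_integral do rewrite EFinM.
  rewrite integralZl// cE -EFinM mulVf// gt_eqF//.
Qed.

Lemma locally_integrable_itv (f : R -> R) (a b : R) :
  locally_integrable setT f -> mu.-integrable `[a, b] (EFin \o f).
Proof.
move=> [mf _ loc]; apply/integrableP; split.
  by apply/measurable_EFinP; exact: measurable_funS mf.
by apply: loc => //; exact: segment_compact.
Qed.

(** As [rho] has integral 1, the error is the integral of [(psi - psi a) * rho]. The ball of radius
    [2 * e] contains the support of [rho] and has measure [4 * e], so the bound [C / e] on [rho]
    becomes [4 * C] times the average. *)
Lemma mollify_le (psi rho : R -> R) (a e C : R) : 0 < e -> 0 <= C ->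
  locally_integrable setT psi -> measurable_fun setT rho ->
  (forall x, 0 <= rho x <= C / e) -> (forall x, ~~ (a < x < a + e) -> rho x = 0) ->
  (\int[mu]_x (rho x)%:E = 1)%E ->
  mu.-integrable setT (EFin \o (fun x => psi x * rho x)) /\
  (`|\int[mu]_x (psi x * rho x)%:E - (psi a)%:E|
     <= (4 * C)%:E * davg psi a (2 * e))%E.
Proof.
move=> e0 C0 lpsi mrho rho01 rho_out rho1.
have mpsi : measurable_fun setT psi by case: lpsi.
have rho0 x : 0 <= rho x by case/andP: (rho01 x).
have irho : mu.-integrable setT (EFin \o rho).
  apply/integrableP; split; first exact/measurable_EFinP.
  under eq_integral do rewrite /= ger0_norm//.
  by rewrite rho1 ltry.
have ipr : mu.-integrable setT (EFin \o (fun x => psi x * rho x)).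
  apply: (@le_integrable _ _ _ mu setT measurableT _
    ((fun x => (C / e)%:E * (psi x)%:E)%E \_ `[a, a + e])).
  - by apply/measurable_EFinP; exact: measurable_funM.
  - move=> x _; rewrite patchE; case: ifPn => [xI|xI]; last first.
      rewrite /= rho_out ?mulr0 ?normr0//; apply/negP => /andP[h1 h2].
      by move/negP: xI; apply; rewrite inE/= in_itv/= !ltW.
    have /andP[r0 r1] := rho01 x.
    rewrite lee_fin !normrM (ger0_norm r0) mulrC ler_wpM2r//.
    by rewrite -normrM; apply: le_trans r1 _; exact: ler_norm.
  - apply/(@integrable_mkcond _ _ _ mu `[a, a + e] (fun x => (C / e)%:E * (psi x)%:E)%E) => //.
    by apply: integrableZl => //; exact: locally_integrable_itv.
split => //.
have -> : (\int[mu]_x (psi x * rho x)%:E - (psi a)%:E =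
    \int[mu]_x ((psi x - psi a) * rho x)%:E)%E.
  have -> : ((psi a)%:E = \int[mu]_x ((psi a)%:E * (EFin \o rho) x))%E.
    by rewrite integralZl// rho1 mule1.
  rewrite -integralB//; last exact: integrableZl.
  by apply: eq_integral => x _ /=; rewrite mulrBl EFinB EFinM.
have m1 : measurable_fun setT (fun x => (psi x - psi a) * rho x).
  by apply: measurable_funM => //; exact: measurable_funB.
apply: le_trans (le_abse_integral _ measurableT _) _; first exact/measurable_EFinP.
have mball : measurable (ball a (2 * e)) by exact: measurable_ball.
have mabs : measurable_fun setT (fun x => `|(psi x - psi a)%:E|)%E.
  apply: measurableT_comp => //; apply/measurable_EFinP.
  exact: measurable_funB.
apply: (@le_trans _ _ (\int[mu]_(x in ball a (2 * e)) ((C / e)%:E * `|(psi x - psi a)%:E|))%E).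
  rewrite [leRHS]integral_mkcond; apply: ge0_le_integral => //.
  - by apply: measurableT_comp => //; exact/measurable_EFinP.
  - apply/(measurable_restrictT _ _).1 => //.
    by apply: measurable_funeM; exact: measurable_funS mabs.
  - move=> x _; rewrite patchE; case: ifPn => [xI|xI].
      have /andP[r0 r1] := rho01 x.
      by rewrite /= lee_fin normrM (ger0_norm r0) mulrC ler_wpM2r.
    rewrite rho_out ?mulr0 ?abse0//; apply/negP => /andP[h1 h2].
    move/negP: xI; apply; rewrite inE/= /ball/= ltr_norml; apply/andP; split; lra.
rewrite ge0_integralZl_EFin//; last 2 first.
  by apply: measurable_funS mabs.
  by rewrite divr_ge0// ltW.
rewrite /davg /iavg lebesgue_measure_ball; last by rewrite mulr_ge0// ltW.
rewrite muleA inver ifF; last by rewrite mulrn_eq0/= mulf_eq0/= pnatr_eq0/= gt_eqF.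
rewrite -EFinM (_ : 4 * C * _ = C / e)//.
by rewrite -mulr_natr; field; rewrite gt_eqF.
Qed.

(* Test against mollified indicators of [[a, b]]: their derivatives are
   approximate identities at [a] and [b]. *)
Lemma weak_deriv_lebesgue_pt (psi dpsi : R -> R) (a b : R) : a < b ->
  weak_deriv psi dpsi -> lebesgue_pt psi a -> lebesgue_pt psi b ->
  ((psi b - psi a)%:E = \int[mu]_(x in `[a, b]) (dpsi x)%:E)%E.
Proof.
move=> ab [lpsi [ldpsi wd]] La Lb.
have [C C0 step] := smooth_step.
pose e (n : nat) : R := n.+1%:R^-1.
have e0 n : 0 < e n by rewrite invr_gt0.
have e1 n : e n <= 1 by rewrite invf_le1// ler1n.
have ecvg (f : R -> \bar R) : f r @[r --> (0:R)^'+] --> 0%E ->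
    f (2 * e n) @[n --> \oo] --> 0%E.
  move=> /cvge_at_rightP/(_ (fun n => 2 * e n)); apply; split.
    by move=> n; rewrite mulr_gt0.
  rewrite -[X in _ --> X](mulr0 2); apply: cvgMr; exact: cvg_harmonic.
have /choice[A HA] n := step a (e n) (e0 n).
have /choice[A' {}HA] := HA.
have /choice[B HB] n := step b (e n) (e0 n).
have /choice[B' {}HB] := HB.
have mollE (c : R) (F : nat -> R -> R) : lebesgue_pt psi c ->
    (forall n, bump_comb (F n)) ->
    (forall n x, 0 <= F n x <= C / e n) ->
    (forall n x, ~~ (c < x < c + e n) -> F n x = 0) ->
    (forall n, \int[mu]_x (F n x)%:E = 1)%E ->
    (forall n, mu.-integrable setT (EFin \o (fun x => psi x * F n x))) /\
    fine (\int[mu]_x (psi x * F n x)%:E)%E @[n --> \oo] --> psi c.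
  move=> Lc bF F01 Fout F1.
  have H n := mollify_le (e0 n) (ltW C0) lpsi
    (continuous_measurable_fun (bump_comb_continuous (bF n))) (F01 n) (Fout n) (F1 n).
  have iF n : mu.-integrable setT (EFin \o (fun x => psi x * F n x)) by case: (H n).
  split => //.
  have fE n : (\int[mu]_x (psi x * F n x)%:E = (fine (\int[mu]_x (psi x * F n x)%:E))%:E)%E.
    by rewrite fineK//; exact: integrable_fin_num (iF n).
  have h0 : ((4 * C)%:E * davg psi c (2 * e n))%E @[n --> \oo] --> 0%E.
    by rewrite -[X in _ --> X](mule0 (4 * C)%:E); apply: cvgeZl => //; exact: ecvg Lc.
  have h1 : (`|(fine (\int[mu]_x (psi x * F n x)%:E) - psi c)%R|%:E)%E @[n --> \oo] --> 0%E.
    apply: (squeeze_cvge _ (cvg_cst 0%E) h0).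
    apply: nearW => n; rewrite lee_fin normr_ge0/=.
    by have [_] := H n; rewrite fE.
  apply/subr_cvg0/norm_cvg0P.
  by move/fine_cvgP : h1 => [_].
have [||||iA cA] := mollE a A' La.
- by move=> n; case: (HA n).
- by move=> n; case: (HA n) => _ _ _ [].
- by move=> n; case: (HA n) => _ _ _ [].
- by move=> n; case: (HA n) => _ _ _ [].
have [||||iB cB] := mollE b B' Lb.
- by move=> n; case: (HB n).
- by move=> n; case: (HB n) => _ _ _ [].
- by move=> n; case: (HB n) => _ _ _ [].
- by move=> n; case: (HB n) => _ _ _ [].
(* A smooth version of the indicator of []a, b]]: it vanishes up to [a] and beyond [b + e n], and
   equals 1 on [[a + e n, b]] once that interval is nonempty. *)
pose phi n x := A n x - B n x.
have dphi n (x : R) : is_derive x 1 (phi n) (A' n x - B' n x).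
  by apply: is_deriveB; [case: (HA n)|case: (HB n)].
have dphiE n : derive1 (phi n) = (fun x => A' n x + -1 * B' n x).
  apply/funext => x; rewrite derive1E mulN1r.
  by have [_ ->] := dphi n x.
have phi_out n x : x <= a \/ b + e n <= x -> phi n x = 0.
  case: (HA n) => _ _ _ [A0 A1 _ _ _]; case: (HB n) => _ _ _ [B0 B1 _ _ _].
  rewrite /phi => -[xa|xb].
    by rewrite A0// B0 ?subrr// (le_trans xa)// ltW.
  by rewrite A1 ?B1 ?subrr//; apply: le_trans xb; rewrite lerD2r ltW.
have tphi n : test_fun (phi n).
  split.
    case=> [|m] x; first by rewrite derive1n0; case: (dphi n x).
    rewrite derive1Sn dphiE; apply: bump_comb_derivable.
    apply: bump_combD; first by case: (HA n).
    by apply: bump_combZ; case: (HB n).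
  exists (`|a| + `|b| + 1) => x xM; apply: phi_out.
  have [xa|xa] := leP x a; [by left|right].
  have ea := ler_norm (- a); rewrite normrN in ea.
  have eb := ler_norm b; have := e1 n.
  have na := normr_ge0 a; have nb := normr_ge0 b.
  by move: xM; rewrite lter_normr => /orP[] ? ?; lra.
have phi1 n x : `|phi n x| <= 1.
  have [_ _ /(_ x)/andP[A0 A1] _] := HA n.
  have [_ _ /(_ x)/andP[B0 B1] _] := HB n.
  by rewrite ler_norml /phi; apply/andP; split; lra.
have mphi n : measurable_fun setT (phi n).
  apply: continuous_measurable_fun => x.
  apply: differentiable_continuous; apply/derivable1_diffP.
  by case: (dphi n x).
have mdpsi : measurable_fun setT dpsi by case: ldpsi.
have key n : fine (\int[mu]_x (psi x * A' n x)%:E)%E - fine (\int[mu]_x (psi x * B' n x)%:E)%E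
    = - fine (\int[mu]_x (dpsi x * phi n x)%:E)%E.
  have := wd _ (tphi n).
  have -> : (\int[mu]_y (psi y * derive1 (phi n) y)%:E =
    \int[mu]_x (psi x * A' n x)%:E - \int[mu]_x (psi x * B' n x)%:E)%E.
    rewrite -integralB; [|by []|exact: iA|exact: iB].
    apply: eq_integral => x _ /=.
    by rewrite dphiE -EFinB mulN1r mulrBr.
  move=> /(congr1 fine); rewrite fineB ?fineN//.
    exact: integrable_fin_num (iA n).
  exact: integrable_fin_num (iB n).
(* Since [e n <= 1], all the [phi n] live on [[a, b + 1]] and are bounded by 1, so [|dpsi|]
   restricted to that interval dominates. *)
have [if_ _ cJ] : [/\ mu.-integrable setT ((fun x => (dpsi x)%:E) \_ `]a, b]),
    [sequence (\int[mu]_x (`| (dpsi x * phi n x)%:E - ((fun x => (dpsi x)%:E) \_ `]a, b]) x |))%E]_n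
      @ \oo --> 0%E &
    [sequence (\int[mu]_x (dpsi x * phi n x)%:E)%E]_n @ \oo -->
      (\int[mu]_x ((fun x => (dpsi x)%:E) \_ `]a, b]) x)%E].
  apply: (@dominated_convergence _ _ _ mu setT measurableT
    (fun n x => (dpsi x * phi n x)%:E) _ ((fun x => `|(dpsi x)%:E|)%E \_ `[a, b + 1])).
  - move=> n; apply/measurable_EFinP.
    exact: (measurable_funM mdpsi (mphi n)).
  - apply/(measurable_restrictT _ _).1 => //.
    by apply/measurable_EFinP; exact: measurable_funS mdpsi.
  - apply: aeW => x _; rewrite patchE.
    have near0 (u : R) : 0 < u -> \forall n \near \oo, e n <= u.
      move=> u0; near=> n; apply: ltW; near: n.
      exact: (near_infty_natSinv_lt (PosNum u0)).
    apply: cvg_near_cst; case: ifPn => xI.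
      move: xI; rewrite inE/= in_itv/= => /andP[ax xb].
      have := near0 (x - a); rewrite subr_gt0 => /(_ ax); apply: filterS => n en.
      case: (HA n) => _ _ _ [_ A1 _ _ _]; case: (HB n) => _ _ _ [B0 _ _ _ _].
      by rewrite /phi A1 ?B0 ?subr0 ?mulr1//; lra.
    have [xa|ax] := leP x a.
      by apply: nearW => n; rewrite phi_out ?mulr0//; left.
    have xb : b < x.
      by rewrite ltNge; apply/negP => xb; move/negP: xI; apply; rewrite inE/= in_itv/= ax.
    have := near0 (x - b); rewrite subr_gt0 => /(_ xb); apply: filterS => n en.
    by rewrite phi_out ?mulr0//; right; lra.
  - apply/(@integrable_mkcond _ _ _ mu `[a, b + 1] (fun x => `|(dpsi x)%:E|)%E) => //.
    by apply: integrable_abse; exact: locally_integrable_itv.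
  - apply: aeW => x n _; rewrite patchE; case: ifPn => xI.
      by rewrite /= lee_fin normrM ler_piMr.
    rewrite phi_out ?mulr0 ?abse0//.
    have [xa|xa] := leP x a; [by left|right].
    have := e1 n; have : b + 1 < x; last by move=> ? ?; lra.
    by rewrite ltNge; apply/negP => xb; move/negP: xI; apply; rewrite inE/= in_itv/= ltW.
have JE : (\int[mu]_x ((fun x => (dpsi x)%:E) \_ `]a, b]) x =
    \int[mu]_(x in `[a, b]) (dpsi x)%:E)%E.
  rewrite -integral_mkcond integral_itv_obnd_cbnd//.
  by apply/measurable_EFinP; exact: measurable_funS mdpsi.
have fJ : (\int[mu]_(x in `[a, b]) (dpsi x)%:E)%E \is a fin_num.
  apply: integrable_fin_num => //; exact: locally_integrable_itv.
rewrite JE in cJ.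
have {}cJ : fine (\int[mu]_x (dpsi x * phi n x)%:E)%E @[n --> \oo] -->
    fine (\int[mu]_(x in `[a, b]) (dpsi x)%:E)%E.
  by rewrite -(fineK fJ) in cJ; move/fine_cvgP : cJ => [_].
pose u n := fine (\int[mu]_x (psi x * A' n x)%:E)%E - fine (\int[mu]_x (psi x * B' n x)%:E)%E.
have c1 : u n @[n --> \oo] --> psi a - psi b by exact: cvgB.
have c2 : u n @[n --> \oo] --> - fine (\int[mu]_(x in `[a, b]) (dpsi x)%:E)%E.
  by rewrite (_ : u = (fun n => - fine (\int[mu]_x (dpsi x * phi n x)%:E)%E));
    [exact: cvgN|apply/funext => n; exact: key].
rewrite -(fineK fJ); congr EFin.
have h : psi a - psi b = - fine (\int[mu]_(x in `[a, b]) (dpsi x)%:E)%E.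
  by rewrite -(cvg_lim _ c1)// -(cvg_lim _ c2).
lra.
Unshelve. all: by end_near. Qed.

End SmoothStep.

(** * Absolutely continuous functions: reflection, gluing, equivalence with weak derivatives *)

Section AbsolutelyContinuous.
Context {R : realType}.
Local Notation mu := (@lebesgue_measure R).
Implicit Types (f D : R -> R) (I : set R) (a b c : R).

(** Absolute continuity is encoded by the integral formula with an explicit density, since the
    energy sees only [D] and no pointwise derivative is ever taken. The set [I] allows half-lines,
    which are then glued. *)
Definition ac_on I f D := forall a b, I a -> I b -> a <= b ->
  mu.-integrable `[a, b] (EFin \o D) /\
  (f b - f a)%:E = (\int[mu]_(x in `[a, b]) (D x)%:E)%E.

Lemma integrable_itv_obnd_cbnd (h : R -> R) a b :
  mu.-integrable `]a, b] (EFin \o h) -> mu.-integrable `[a, b] (EFin \o h).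
Proof.
move=> /integrableP[mh ih]; apply/integrableP; split.
  by apply/measurable_EFinP/measurable_fun_itv_obnd_cbndP/measurable_EFinP.
rewrite -integral_itv_obnd_cbnd//.
exact: measurableT_comp.
Qed.

Lemma integral_itv_split (h : R -> \bar R) a b c : a <= b -> b <= c ->
  mu.-integrable `[a, c] h ->
  (\int[mu]_(x in `[a, c]) h x =
   \int[mu]_(x in `[a, b]) h x + \int[mu]_(x in `[b, c]) h x)%E.
Proof.
move=> ab bc ih.
have mh : measurable_fun `[a, c] h by exact: measurable_int ih.
have s1 : `[a, b] `<=` `[a, c] by apply: subset_itvl; rewrite bnd_simp.
have s2 : `]b, c] `<=` `[a, c] by apply: subset_itvr; rewrite bnd_simp.
rewrite -(@integral_itv_obnd_cbnd _ b (BRight c)); last exact: measurable_funS mh.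
rewrite -integral_setU//=.
- by rewrite -itv_bndbnd_setU// bnd_simp.
- apply: measurable_funS mh => //.
  by move=> x [/s1|/s2].
- by apply/disj_setPS => x [] /=; rewrite !in_itv/= => /andP[_ xb] /andP[]; rewrite ltNge xb.
Qed.

Lemma ge0_integral_itv_split (h : R -> \bar R) a b c : a <= b -> b <= c ->
  measurable_fun setT h -> (forall x, 0 <= h x)%E ->
  (\int[mu]_(x in `[a, c]) h x =
   \int[mu]_(x in `[a, b]) h x + \int[mu]_(x in `[b, c]) h x)%E.
Proof.
move=> ab bc mh h0.
rewrite -(@integral_itv_obnd_cbnd _ b (BRight c)); last exact: measurable_funS mh.
rewrite -ge0_integral_setU//=.
- by rewrite -itv_bndbnd_setU// bnd_simp.
- exact: measurable_funS mh.
- by apply/disj_setPS => x [] /=; rewrite !in_itv/= => /andP[_ xb] /andP[]; rewrite ltNge xb.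
Qed.

Lemma ge0_integral_itv_splitNy (h : R -> \bar R) b c : b <= c ->
  measurable_fun setT h -> (forall x, 0 <= h x)%E ->
  (\int[mu]_(x in `]-oo, c]) h x =
   \int[mu]_(x in `]-oo, b]) h x + \int[mu]_(x in `[b, c]) h x)%E.
Proof.
move=> bc mh h0.
rewrite -(@integral_itv_obnd_cbnd _ b (BRight c)); last exact: measurable_funS mh.
rewrite -ge0_integral_setU//=.
- by rewrite -itv_bndbnd_setU// bnd_simp.
- exact: measurable_funS mh.
- by apply/disj_setPS => x [] /=; rewrite !in_itv/= => xb /andP[]; rewrite ltNge xb.
Qed.

Lemma ge0_integral_splitT (h : R -> \bar R) b :
  measurable_fun setT h -> (forall x, 0 <= h x)%E ->
  (\int[mu]_x h x = \int[mu]_(x in `]-oo, b]) h x + \int[mu]_(x in `[b, +oo[) h x)%E.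
Proof.
move=> mh h0.
rewrite -(@integral_itv_obnd_cbnd _ b); last exact: measurable_funS mh.
rewrite -ge0_integral_setU//=.
- by rewrite -itv_bndbnd_setU// set_itvNyy.
- exact: measurable_funS mh.
- by apply/disj_setPS => x [] /=; rewrite !in_itv/= andbT => xb; rewrite ltNge xb.
Qed.

Lemma measurable_reflection c :
  measurable_fun setT ((fun x => c - x) : measurableTypeR R -> measurableTypeR R).
Proof. exact: measurable_funB. Qed.

Lemma reflection_measure c (A : set R) : measurable A ->
  pushforward mu ((fun x => c - x) : measurableTypeR R -> measurableTypeR R) A = mu A.
Proof.
move=> mA; apply/esym/lebesgue_measure_unique => //=; first exact: measurable_reflection.
move=> _ _ [[a b]] _ <-.
rewrite /pushforward (_ : _ @^-1` _ = `[c - b, c - a[%classic); last first.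
  apply/seteqP; split => x /=; rewrite !in_itv/= => /andP[h1 h2].
    by apply/andP; split; lra.
  by apply/andP; split; lra.
rewrite !lebesgue_measure_itv/= !lte_fin ltrD2l ltrN2; case: ifPn => // _.
by rewrite -!EFinB; congr EFin; ring.
Qed.

Lemma ge0_integral_reflect (h : R -> \bar R) c (A : set R) : measurable A ->
  measurable_fun setT h -> (forall x, 0 <= h x)%E ->
  (\int[mu]_(x in A) h x = \int[mu]_(x in (fun x => c - x)%R @^-1` A) h (c - x)%R)%E.
Proof.
move=> mA mh h0.
rewrite -(@ge0_integral_pushforward _ _ _ _ _ _ (measurable_reflection c) mu A h)//;
  last exact: measurable_funS mh.
apply: eq_measure_integral => //=; first exact: measurable_reflection.
by move=> _ B mB BA; exact/esym/reflection_measure.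
Qed.

Lemma integral_reflect (h : R -> \bar R) c (A : set R) : measurable A ->
  measurable_fun setT h -> mu.-integrable A h ->
  mu.-integrable ((fun x => c - x)%R @^-1` A) (fun x => h (c - x)%R) /\
  (\int[mu]_(x in A) h x = \int[mu]_(x in (fun x => c - x)%R @^-1` A) h (c - x)%R)%E.
Proof.
move=> mA mh ih.
have mp : measurable ((fun x => c - x) @^-1` A).
  by rewrite -[X in measurable X]setTI; exact: (measurable_reflection c).
have ih' : mu.-integrable ((fun x => c - x)%R @^-1` A) (fun x => h (c - x)%R).
  apply/integrableP; split.
    apply: measurable_funTS.
    exact: (measurableT_comp mh (measurable_reflection c)).
  move/integrableP: ih => [_]; rewrite (@ge0_integral_reflect (fun x => `|h x|)%E c)//.
  exact: measurableT_comp.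
split => //.
rewrite -(@integral_pushforward _ _ _ _ _ _ (measurable_reflection c) mu A h)//.
apply: eq_measure_integral => //=; first exact: measurable_reflection.
by move=> _ B mB BA; exact/esym/reflection_measure.
Qed.

Lemma preimage_reflect_itvcc c a b :
  (fun x => c - x) @^-1` `[a, b] = `[c - b, c - a]%classic.
Proof.
by apply/seteqP; split => x /=; rewrite !in_itv/= => /andP[h1 h2]; apply/andP; split; lra.
Qed.

Lemma preimage_reflect_itvcy c a :
  (fun x => c - x) @^-1` `[a, +oo[ = `]-oo, c - a]%classic.
Proof. by apply/seteqP; split => x /=; rewrite !in_itv/= ?andbT => h; lra. Qed.

Lemma ac_on_reflect I f D c : measurable_fun setT D -> ac_on I f D ->
  ac_on ((fun x => c - x) @^-1` I) (fun x => f (c - x)) (fun x => - D (c - x)).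
Proof.
move=> mD acf a b /= Ia Ib ab.
have [iD fE] := acf (c - b) (c - a) Ib Ia (lerB (lexx c) ab).
have mDE : measurable_fun setT (EFin \o D) by exact/measurable_EFinP.
have [] := integral_reflect c (measurable_itv _) mDE iD.
rewrite preimage_reflect_itvcc !subKr => iD' E.
split; first by apply: eq_integrable (integrableN iD') => //.
rewrite -opprB EFinN fE E -integralN.
  by apply: eq_integral => x _; rewrite EFinN.
by rewrite fin_num_adde_defl// fin_numN; exact: integrable_neg_fin_num.
Qed.

Lemma ac_on_glue f1 D1 f2 D2 c : f1 c = f2 c ->
  ac_on [set x | x <= c] f1 D1 -> ac_on [set x | c <= x] f2 D2 ->
  ac_on setT (fun x => if x <= c then f1 x else f2 x)
             (fun x => if x <= c then D1 x else D2 x).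
Proof.
move=> fc ac1 ac2 a b _ _ ab.
set D := fun x => if x <= c then D1 x else D2 x.
have left x y : x <= y -> y <= c -> mu.-integrable `[x, y] (EFin \o D) /\
    (f1 y - f1 x)%:E = (\int[mu]_(t in `[x, y]) (D t)%:E)%E.
  move=> xy yc; have [i1 e1] := ac1 x y (le_trans xy yc) yc xy.
  have E : {in `[x, y], EFin \o D1 =1 EFin \o D}.
    by move=> t; rewrite in_itv/= => /andP[_ ty]; rewrite /D /= (le_trans ty yc).
  split; first by apply: eq_integrable i1 => // t; rewrite inE => /E.
  by rewrite e1; apply: eq_integral => t; rewrite inE => /E.
have right x y : x <= y -> c <= x -> mu.-integrable `[x, y] (EFin \o D) /\
    (f2 y - f2 x)%:E = (\int[mu]_(t in `[x, y]) (D t)%:E)%E.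
  move=> xy cx; have [i2 e2] := ac2 x y cx (le_trans cx xy) xy.
  (* At [c] the glued density takes the value [D1 c], so when [x = c] agreement with [D2] holds only
     on the half-open interval; the missing point is null. *)
  have E : {in `]x, y], EFin \o D2 =1 EFin \o D}.
    move=> t; rewrite in_itv/= => /andP[xt _].
    by rewrite /D /= ifF//; apply/negbTE; rewrite -ltNge (le_lt_trans cx).
  have i2' : mu.-integrable `]x, y] (EFin \o D2).
    by apply: integrableS i2 => //; apply: subset_itvr; rewrite bnd_simp.
  have i2D : mu.-integrable `]x, y] (EFin \o D).
    by apply: eq_integrable i2' => // t; rewrite inE => /E.
  split; first exact: integrable_itv_obnd_cbnd.
  rewrite e2 -integral_itv_obnd_cbnd; last exact: measurable_int i2'.
  rewrite -[RHS]integral_itv_obnd_cbnd; last exact: measurable_int i2D.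
  by apply: eq_integral => t; rewrite inE => /E.
have [bc|cb] := leP b c; first by rewrite (le_trans ab bc); exact: left.
have [ac|ca] := leP a c; last by exact: right (ltW ca).
have [il el] := left a c ac (lexx c).
have [ir er] := right c b (ltW cb) (lexx c).
have iD : mu.-integrable `[a, b] (EFin \o D).
  rewrite (_ : `[a, b]%classic = `[a, c] `|` `]c, b]); last first.
    by rewrite -itv_bndbnd_setU// bnd_simp ltW.
  have ir' : mu.-integrable `]c, b] (EFin \o D).
    by apply: integrableS ir => //; apply: subset_itvr; rewrite bnd_simp.
  have mU : measurable_fun (`[a, c] `|` `]c, b]) (EFin \o D).
    by apply/measurable_funU => //; split; [exact: measurable_int il|exact: measurable_int ir'].
  apply/integrableP; split => //.
  rewrite ge0_integral_setU//; last 2 first.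
    exact: measurableT_comp.
    by apply/disj_setPS => x [] /=; rewrite !in_itv/= => /andP[_ xb] /andP[]; rewrite ltNge xb.
  by apply: lte_add_pinfty; [case/integrableP: il|case/integrableP: ir'].
split => //.
rewrite (integral_itv_split ac (ltW cb) iD) -el -er -EFinD fc; congr EFin; ring.
Qed.

Lemma ac_on_sub I J f D : J `<=` I -> ac_on I f D -> ac_on J f D.
Proof. by move=> JI acf a b /JI Ia /JI Ib; exact: acf. Qed.

Lemma ac_continuous f D : ac_on setT f D -> continuous f.
Proof.
move=> acf x.
have x1 : x - 1 < x + 1 by lra.
have [iD _] := acf (x - 1) (x + 1) I I (ltW x1).
have := parameterized_integral_continuous (ltW x1) iD.
move/(continuous_within_itvP _ x1) => [+ _ _].
have xI : x \in `]x - 1, x + 1[ by rewrite in_itv/=; apply/andP; split; lra.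
move=> /(_ x xI) cp.
have c2 : f (x - 1) + parameterized_integral mu (x - 1) y D @[y --> x] -->
    f (x - 1) + parameterized_integral mu (x - 1) x D.
  by apply: cvgD => //; exact: cvg_cst.
have E y : x - 1 <= y -> f y = f (x - 1) + parameterized_integral mu (x - 1) y D.
  move=> xy; have [_] := acf (x - 1) y I I xy.
  move=> /(congr1 fine)/=; rewrite /parameterized_integral /Rintegral => <-.
  by rewrite addrC subrK.
rewrite /continuous_at E; last by lra.
apply: cvg_trans c2; apply: near_eq_cvg; near=> y.
rewrite -E//; apply: ltW; near: y; apply: lt_nbhsr; lra.
Unshelve. all: by end_near. Qed.

Lemma ae_exists (P : R -> Prop) : {ae mu, forall x, P x} -> exists x, P x.
Proof.
move=> [A [mA A0 sA]]; apply: contrapT => nP.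
have AT : `[0%R, 1%R]%classic `<=` A.
  by move=> x _; apply: sA => Px; apply: nP; exists x.
have : (mu `[0%R, 1%R] <= mu A)%E by apply: le_measure => //; rewrite inE.
by rewrite A0 lebesgue_measure_itv/= lte_fin ltr01 oppr0 adde0 lee_fin ler10.
Qed.

(** Almost every point is a Lebesgue point of [psi]. Fix one of them, [a0], and let [f] be the
    primitive of [dpsi] with value [psi a0] there; at every other Lebesgue point the increment
    formula forces [psi] and [f] to agree. *)
Lemma weak_deriv_ac (psi dpsi : R -> R) : weak_deriv psi dpsi ->
  exists f, [/\ ac_on setT f dpsi, continuous f & {ae mu, forall x, psi x = f x}].
Proof.
move=> wd; have [lpsi [ldpsi _]] := wd.
have Lae := lebesgue_differentiation lpsi.
have [a0 La0] := ae_exists Lae.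
have iD x y : mu.-integrable `[x, y] (EFin \o dpsi) by exact: locally_integrable_itv.
pose J x y := fine (\int[mu]_(t in `[x, y]) (dpsi t)%:E)%E.
have JE x y : (\int[mu]_(t in `[x, y]) (dpsi t)%:E)%E = (J x y)%:E.
  by rewrite /J fineK//; exact: integrable_fin_num.
have Jadd x y t : x <= y -> y <= t -> J x t = J x y + J y t.
  move=> xy yt; apply: EFin_inj; rewrite EFinD -!JE.
  exact: integral_itv_split.
pose f y := if a0 <= y then psi a0 + J a0 y else psi a0 - J y a0.
have acf : ac_on setT f dpsi.
  move=> a b _ _ ab; split => //; rewrite JE; congr EFin; rewrite /f.
  have [h1|h1] := leP a0 a.
    rewrite (le_trans h1 ab) (Jadd _ _ _ h1 ab); ring.
  have [h2|h2] := leP a0 b.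
    rewrite (Jadd _ _ _ (ltW h1) h2); ring.
  rewrite (Jadd _ _ _ ab (ltW h2)); ring.
exists f; split => //; first exact: ac_continuous acf.
apply: (@filterS _ _ (ae_filter_ringOfSetsType mu) _ _ _ Lae) => x Lx; rewrite /f.
have [h|h|->] := ltgtP a0 x.
- have := weak_deriv_lebesgue_pt h wd La0 Lx; rewrite JE => -[<-]; ring.
- have := weak_deriv_lebesgue_pt h wd Lx La0; rewrite JE => -[<-]; ring.
- by rewrite /J set_itv1 integral_set1/= addr0.
Qed.

Lemma ac_locally_integrable f D : measurable_fun setT D -> ac_on setT f D ->
  locally_integrable setT f /\ locally_integrable setT D.
Proof.
move=> mD acf; have cf := ac_continuous acf; split; split => //.
- exact: continuous_measurable_fun.
- exact: openT.
- move=> K _ cK.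
  have /integrableP[_] : mu.-integrable K (EFin \o f).
    by apply: continuous_compact_integrable => //; exact: continuous_subspaceT.
  by [].
- exact: openT.
- move=> K _ cK; have [M [_ HM]] := compact_bounded cK.
  have KM : K `<=` `[- (M + 1), M + 1]%classic.
    move=> x Kx; have M1 : M < M + 1 by rewrite ltrDl.
    by have /= := HM _ M1 x Kx; rewrite /= in_itv/= ler_norml.
  have [[y Ky]|nK] := pselect (exists y, K y); last first.
    rewrite (_ : K = set0) ?integral_set0//; apply/seteqP; split => // y Ky.
    by apply: nK; exists y.
  have M0 : - (M + 1) <= M + 1 by have /= := KM y Ky; rewrite in_itv/= => /andP[]; exact: le_trans.
  have [/integrableP[_ iD] _] := acf (- (M + 1)) (M + 1) I I M0.
  apply: le_lt_trans iD; apply: ge0_subset_integral => //.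
    exact: compact_measurable.
  by apply/measurable_EFinP; apply: measurableT_comp => //; exact: measurable_funS mD.
Qed.

(* Fubini on the triangle [x <= y] for [D x * phi' y]. *)
Lemma ac_weak_deriv f D : measurable_fun setT D -> ac_on setT f D -> weak_deriv f D.
Proof.
move=> mD acf; have [lf lD] := ac_locally_integrable mD acf.
split => //; split => // phi [phiS [M0 phi0]].
have cf := ac_continuous acf.
pose M : R := `|M0| + 1.
have M_gt0 : 0 < M by rewrite ltr_pwDr.
have M0M : M0 < M by rewrite /M; have := ler_norm M0; lra.
have phiM x : M <= `|x| -> phi x = 0 by move=> h; apply: phi0; exact: lt_le_trans h.
pose dphi : R -> R := derive1 phi.
have dphiE (x : R) : derivable phi x 1 by have := phiS 0%N x; rewrite derive1n0.
have cphi : continuous phi.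
  by move=> x; apply: differentiable_continuous; apply/derivable1_diffP.
have cdphi : continuous dphi.
  move=> x; apply: differentiable_continuous; apply/derivable1_diffP.
  by have := phiS 1%N x; rewrite derive1n1.
have mdphi : measurable_fun setT dphi by exact: continuous_measurable_fun.
have mphi : measurable_fun setT phi by exact: continuous_measurable_fun.
have dphi0 x : M < `|x| -> dphi x = 0.
  move=> xM; rewrite /dphi derive1E.
  have : is_derive x 1 phi 0.
    apply: (@near_eq_is_derive _ _ _ (cst 0)).
    near=> y; rewrite phiM// ltW//; near: y.
    have /cvgr_gt := @norm_continuous _ R x; exact.
  by case.
pose J : set R := `[- M, M]%classic.
have mJ : measurable J by exact: measurable_itv.
have notJ x : x \notin J -> M < `|x|.
  by move=> /negP; rewrite /J inE/= in_itv/= -ler_norml => /negP; rewrite -ltNge.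
have inJ x : x \in J -> - M <= x <= M by rewrite /J inE/= in_itv.
have [iD fM] := acf (- M) M I I (ltW (gtrN M_gt0)).
have FTC x : - M <= x <= M -> (\int[mu]_(y in `[x, M]) (dphi y)%:E = (- phi x)%:E)%E.
  move=> /andP[xM]; rewrite le_eqVlt => /predU1P[->|xM'].
    by rewrite set_itv1 integral_set1 phiM ?oppr0// ger0_norm// ltW.
  rewrite (@continuous_FTC2 _ dphi phi)//.
  - by rewrite (phiM M) ?add0e// ger0_norm// ltW.
  - exact: continuous_subspaceT.
  - split => //.
      by apply: cvg_at_right_filter; exact: cphi.
    by apply: cvg_at_left_filter; exact: cphi.
(* Cutting off to [[- M, M]], outside which [phi] and its derivative vanish, makes both factors
   integrable on the line, as Fubini requires. *)
pose u x : R := (D \_ J) x.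
pose v x : R := (dphi \_ J) x.
have mu_ : measurable_fun setT u.
  by apply/(measurable_restrictT _ _).1 => //; exact: measurable_funS mD.
have mv : measurable_fun setT v.
  by apply/(measurable_restrictT _ _).1 => //; exact: measurable_funS mdphi.
have iu : mu.-integrable setT (EFin \o u).
  have := (@integrable_mkcond _ _ _ mu J (EFin \o D) mJ).1 iD.
  by apply: eq_integrable => // x _; rewrite /u /= !patchE; case: ifP.
have iv : mu.-integrable setT (EFin \o v).
  have i1 : mu.-integrable J (EFin \o dphi).
    by apply: continuous_compact_integrable; [exact: segment_compact|exact: continuous_subspaceT].
  have := (@integrable_mkcond _ _ _ mu J (EFin \o dphi) mJ).1 i1.
  by apply: eq_integrable => // x _; rewrite /v /= !patchE; case: ifP.
pose F (p : measurableTypeR R * measurableTypeR R) : \bar R :=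
  (if p.1 <= p.2 then u p.1 * v p.2 else 0)%:E.
have mF : measurable_fun setT F.
  apply/measurable_EFinP; apply: measurable_fun_ifT => //=.
  - apply: measurable_fun_ler; [exact: measurable_fst|exact: measurable_snd].
  - apply: measurable_funM.
      exact: (measurableT_comp mu_ measurable_fst).
    exact: (measurableT_comp mv measurable_snd).
have iF : (mu \x mu)%E.-integrable setT F.
  apply: (proj2 (@integrable12ltyP _ _ _ _ R mu mu F mF)).
  pose V := (\int[mu]_y `|(v y)%:E|)%E.
  have Voo : (V < +oo)%E by case/integrableP: iv.
  have V0 : (0 <= V)%E by exact: integral_ge0.
  have mabsu : measurable_fun setT (fun x => `|(u x)%:E|)%E.
    by apply: measurableT_comp => //; exact/measurable_EFinP.
  have mabsv : measurable_fun setT (fun x => `|(v x)%:E|)%E.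
    by apply: measurableT_comp => //; exact/measurable_EFinP.
  apply: (@le_lt_trans _ _ (\int[mu]_x (`|(u x)%:E| * V))%E).
    apply: ge0_le_integral => //.
    - by move=> x _; exact: integral_ge0.
    - apply: (measurable_fun_fubini_tonelli_F (abse \o F)) => //=.
      exact: measurableT_comp.
    - exact: emeasurable_funM.
    - move=> x _; rewrite /V -ge0_integralZl//.
      apply: ge0_le_integral => //.
      + apply: measurableT_comp => //.
        exact: (measurableT_comp mF (measurable_pair1 x)).
      + exact: measurable_funeM.
      + move=> y _; rewrite /F /=; case: ifP => _; first by rewrite normrM.
        by rewrite normr0 mule_ge0.
  rewrite ge0_integralZr//.
  have Uoo : (\int[mu]_x `|(u x)%:E| < +oo)%E by case/integrableP: iu.
  have U0 : (0 <= \int[mu]_x `|(u x)%:E|)%E by exact: integral_ge0.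
  by apply: lte_mul_pinfty => //; rewrite ge0_fin_numE.
have innerL x : (\int[mu]_y F (x, y) = (- (D x * phi x))%:E)%E.
  have [xJ|xJ] := boolP (x \in J); last first.
    rewrite phiM ?mulr0 ?oppr0; last by rewrite ltW// notJ.
    apply: integral0_eq => y _; rewrite /F/= /u patchE (negbTE xJ) mul0r.
    by case: ifP.
  have /andP[x1 x2] := inJ x xJ.
  have E y : F (x, y) = ((D x)%:E * ((EFin \o dphi) \_ `[x, M]) y)%E.
    rewrite /F/= /u /v !patchE xJ; case: ifPn => xy; last first.
      rewrite ifF ?mule0//; apply/negbTE/negP; rewrite inE/= in_itv/= => /andP[xy' _].
      by rewrite xy' in xy.
    have -> : (y \in J) = (y \in `[x, M]%classic).
      by apply/idP/idP; rewrite /J !inE/= !in_itv/= => /andP[h1 h2];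
        apply/andP; split => //; exact: le_trans xy.
    by case: ifP => _; rewrite ?mulr0 ?mule0.
  under eq_integral do rewrite E.
  rewrite integralZl//.
    by rewrite -integral_mkcond FTC ?x1// -EFinM mulrN.
  apply/(@integrable_mkcond _ _ _ mu `[x, M] (EFin \o dphi)) => //.
  by apply: continuous_compact_integrable; [exact: segment_compact|exact: continuous_subspaceT].
have innerR y : (\int[mu]_x F (x, y) = (v y * (f y - f (- M)))%:E)%E.
  rewrite /v patchE; case: ifPn => yJ; last first.
    rewrite mul0r; apply: integral0_eq => x _.
    by rewrite /F/= /v patchE (negbTE yJ) mulr0; case: ifP.
  have /andP[y1 y2] := inJ y yJ.
  have [iDy fy] := acf (- M) y I I y1.
  have E x : F (x, y) = ((dphi y)%:E * ((EFin \o D) \_ `[(- M)%R, y]) x)%E.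
    rewrite /F/= /u /v !patchE yJ; case: ifPn => xy; last first.
      rewrite ifF ?mule0//; apply/negbTE/negP; rewrite inE/= in_itv/= => /andP[_ xy'].
      by rewrite xy' in xy.
    have -> : (x \in J) = (x \in `[- M, y]%classic).
      by apply/idP/idP; rewrite /J !inE/= !in_itv/= => /andP[h1 h2];
        apply/andP; split => //; exact: le_trans y2.
    by case: ifP => _; rewrite ?mul0r ?mule0 // mulrC.
  under eq_integral do rewrite E.
  rewrite integralZl//.
    by rewrite -integral_mkcond -fy.
  exact/(@integrable_mkcond _ _ _ mu `[- M, y] (EFin \o D)).
have ivf : mu.-integrable setT (EFin \o (fun y => f y * dphi y)).
  have i1 : mu.-integrable J (EFin \o (fun y => f y * dphi y)).
    apply: continuous_compact_integrable; first exact: segment_compact.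
    apply: continuous_subspaceT => y.
    by apply: cvgM; [exact: cf|exact: cdphi].
  have := (@integrable_mkcond _ _ _ mu J _ mJ).1 i1.
  apply: eq_integrable => // x _; rewrite /= !patchE; case: ifPn => //= xJ.
  by rewrite dphi0 ?mulr0// notJ.
have : (\int[mu]_x (- (D x * phi x))%:E = \int[mu]_y (v y * (f y - f (- M)))%:E)%E.
  transitivity (\int[mu]_x \int[mu]_y F (x, y))%E.
    by apply: eq_integral => x _; rewrite innerL.
  transitivity (\int[mu]_y \int[mu]_x F (x, y))%E; first exact: (Fubini iF).
  by apply: eq_integral => x _; rewrite innerR.
have iL := integrable_fubini_F iF.
have {}iL : mu.-integrable setT (fun x => (- (D x * phi x))%:E).
  by apply: eq_integrable iL => // x _; exact: innerL.
have iDphi : mu.-integrable setT (fun x => (D x * phi x)%:E).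
  by apply: eq_integrable (integrableN iL) => // x _; rewrite /= opprK.
have -> : (\int[mu]_x (- (D x * phi x))%:E = - \int[mu]_x (D x * phi x)%:E)%E.
  rewrite -integralN; first by apply: eq_integral => x _; rewrite EFinN.
  by rewrite fin_num_adde_defl// fin_numN; exact: integrable_neg_fin_num.
(* The constant [f (- M)] drops out because the derivative of a compactly supported function
   integrates to 0. *)
have -> : (\int[mu]_y (v y * (f y - f (- M)))%:E = \int[mu]_y (f y * dphi y)%:E)%E.
  have E y : ((v y * (f y - f (- M)))%:E = (f y * dphi y)%:E - (f (- M))%:E * (v y)%:E)%E.
    rewrite -EFinM -EFinB; congr EFin; rewrite /v patchE; case: ifPn => yJ; first by ring.
    by rewrite dphi0 ?notJ// (_ : point = 0 :> R)//; ring.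
  under eq_integral do rewrite E.
  rewrite integralB//; last exact: integrableZl.
  rewrite integralZl// (_ : \int[mu]_x (v x)%:E = 0)%E ?mule0 ?sube0//.
  transitivity (\int[mu]_(x in J) (dphi x)%:E)%E.
    by rewrite [RHS]integral_mkcond; apply: eq_integral => x _; rewrite /v !patchE; case: ifP.
  rewrite FTC ?lexx ?(ltW (gtrN M_gt0))//.
  by rewrite phiM ?oppr0// normrN ger0_norm// ltW.
by move=> ->.
Unshelve. all: by end_near. Qed.

(** The point is the supremum of the superlevel set in [[a, b]], and continuity keeps it inside that
    set. It serves to cut a profile at its last crossing of a level. *)
Lemma last_ge f a b (v : R) : continuous f -> a <= b -> v <= f a ->
  exists2 u, a <= u <= b & v <= f u /\ forall x, u < x -> x <= b -> f x < v.
Proof.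
move=> cf ab va.
pose S := [set x | a <= x <= b /\ v <= f x].
have Sa : S a by split => //; rewrite lexx.
have supS : has_sup S.
  split; first by exists a.
  by exists b => x [/andP[]].
have au : a <= sup S by apply: ub_le_sup Sa; case: supS.
have ub : sup S <= b by apply: ge_sup; [by exists a|move=> x [/andP[]]].
exists (sup S); first by rewrite au.
split.
  rewrite leNgt; apply/negP => fu.
  have /cvgr_lt/(_ _ fu) := cf (sup S).
  move=> [/= e e0 He].
  have [x [/andP[ax xb] vx] xe] := sup_adherent e0 supS.
  have xs : x <= sup S by apply: ub_le_sup; [case: supS|split => //; rewrite ax].
  have : f x < v.
    apply: He; rewrite /ball/= ger0_norm ?subr_ge0//; lra.
  by rewrite ltNge vx.
move=> x ux xb; rewrite ltNge; apply/negP => vx.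
have : x <= sup S.
  by apply: ub_le_sup; [case: supS|split => //; rewrite xb (le_trans au (ltW ux))].
by rewrite leNgt ux.
Qed.

End AbsolutelyContinuous.

(** * Measurability and primitive of the kernel *)

Section Kernel.
Context {R : realType}.
Local Notation mu := (@lebesgue_measure R).

Lemma nonincreasing_emeasurable (f : R -> \bar R) :
  (forall x y, x <= y -> (f y <= f x)%E) -> measurable_fun setT f.
Proof.
move=> fni.
apply: (measurability _ (ErealGenOInfty.measurableE R)).
move=> _ [_ [r ->] <-]; rewrite setTI.
apply: is_interval_measurable => x y /= _ + t /andP[_ ty].
by rewrite !in_itv/= !andbT => /lt_le_trans; apply; exact: fni.
Qed.

Lemma r_ker_ge0 (x : R) : 0 <= r_ker x.
Proof. by rewrite /r_ker; case: ifP => // _; rewrite divr_ge0// mulr_ge0. Qed.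

Lemma ker_continuous (t s : R) : t < s ->
  {for s, continuous (fun x => 2 * Num.sqrt 2 / (3 * Num.sqrt (x - t)))}.
Proof.
move=> ts; apply: cvgMr; apply: cvgV.
  by rewrite mulf_neq0// sqrtr_eq0 -ltNge subr_gt0.
apply: cvgMr; apply: (@continuous_comp _ _ _ (fun x : R => x - t)).
  by apply: cvgB => //; exact: cvg_cst.
exact: sqrt_continuous.
Qed.

Lemma measurable_r_ker (t : R) : measurable_fun setT (fun s : R => r_ker (t - s)).
Proof.
have -> : (fun s : R => r_ker (t - s)) =
    (fun s => 2 * Num.sqrt 2 / (3 * Num.sqrt (s - t))) \_ `]t, +oo[.
  apply/funext => s; rewrite patchE /r_ker subr_lt0 opprB.
  have -> : (s \in `]t, +oo[%classic) = (t < s).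
    by apply/idP/idP; rewrite inE/= in_itv/= andbT.
  by case: ifP.
apply/(measurable_restrictT _ _).1 => //.
apply: open_continuous_measurable_fun; first exact: interval_open.
move=> s; rewrite inE/= in_itv/= andbT; exact: ker_continuous.
Qed.

(** A primitive of the kernel in [s] is [4/3 sqrt 2 sqrt(s - t)]. The singularity at [t] is
    approached by the intervals [[a n, A]] and monotone convergence. *)
Lemma integral_r_ker (t A : R) :
  (\int[mu]_(s in `]-oo, A]) (r_ker (t - s))%:E
    = (4 / 3 * Num.sqrt 2 * Num.sqrt (A - t))%:E)%E.
Proof.
have [At|tA] := leP A t.
  rewrite (_ : Num.sqrt (A - t) = 0) ?mulr0; last by rewrite ler0_sqrtr// subr_le0.
  apply: integral0_eq => s /=.
  rewrite in_itv/= => sA; rewrite /r_ker ifF//; apply/negbTE.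
  by rewrite -leNgt subr_ge0 (le_trans sA).
pose F (s : R) : R := 4 / 3 * Num.sqrt 2 * Num.sqrt (s - t).
have dF s : t < s -> is_derive s 1 F (r_ker (t - s)).
  move=> ts.
  have d1 : is_derive s 1 (fun x : R => x - t) 1.
    have := is_deriveB (is_derive_id s (1:R)) (is_derive_cst t s (1:R)).
    by move=> h; apply: is_derive_eq h _; rewrite subr0.
  have st0 : 0 < s - t by rewrite subr_gt0.
  have d2 := @is_derive1_comp _ _ (fun x : R => x - t) _ _ _ (is_derive1_sqrt st0) d1.
  apply: is_derive_eq (is_deriveZ (4 / 3 * Num.sqrt 2) d2) _.
  rewrite /GRing.scale/= /r_ker subr_lt0 ts opprB; field.
  by rewrite sqrtr_eq0 -ltNge.
have cF s : t < s -> {for s, continuous F}.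
  move=> ts; apply: differentiable_continuous; apply/derivable1_diffP.
  by case: (dF s ts).
have cFt : {for t, continuous F}.
  apply: cvgMr; apply: (@continuous_comp _ _ _ (fun x : R => x - t)).
    by apply: cvgB => //; exact: cvg_cst.
  exact: sqrt_continuous.
have FTC a : t < a -> a < A -> (\int[mu]_(s in `[a, A]) (r_ker (t - s))%:E = (F A - F a)%:E)%E.
  move=> ta aA; rewrite (@continuous_FTC2 _ _ F) ?EFinB//.
  - apply/(continuous_within_itvP _ aA).
    have ck s : t < s -> {for s, continuous (fun s => r_ker (t - s))}.
      move=> ts.
      have cs := ker_continuous ts.
      rewrite /prop_for /continuous_at {2}/r_ker subr_lt0 ts opprB.
      apply: cvg_trans cs; apply: near_eq_cvg; near=> x.
      rewrite /r_ker subr_lt0 ifT ?opprB//; near: x; exact: lt_nbhsr.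
    split.
    + by move=> x; rewrite in_itv/= => /andP[ax _]; apply: ck; exact: lt_trans ax.
    + by apply: cvg_at_right_filter; exact: ck.
    + by apply: cvg_at_left_filter; apply: ck; exact: lt_trans aA.
  - split.
    + by move=> x; rewrite in_itv/= => /andP[ax _]; case: (dF x (lt_trans ta ax)).
    + by apply: cvg_at_right_filter; exact: cF.
    + by apply: cvg_at_left_filter; apply: cF; exact: lt_trans aA.
  - move=> x; rewrite in_itv/= => /andP[ax _].
    by rewrite derive1E; case: (dF x (lt_trans ta ax)).
(* The shift [n.+2] makes even [a 0] strictly smaller than [A], as [FTC] demands. *)
pose a (n : nat) := t + (A - t) * (n.+2%:R)^-1.
have ta n : t < a n by rewrite /a ltrDl mulr_gt0// subr_gt0.
have aA n : a n < A.
  by rewrite /a -ltrBrDl gtr_pMr ?subr_gt0// invf_lt1// ltr1n.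
have acvg : a n @[n --> \oo] --> t.
  rewrite -[X in _ --> X]addr0; apply: cvgD; first exact: cvg_cst.
  rewrite -[X in _ --> X](mulr0 (A - t)); apply: cvgMr.
  by have := @cvg_harmonic R; rewrite -(@cvg_shiftS R^o harmonic).
have cc : F (a n) @[n --> \oo] --> F t.
  by apply: (@cvg_comp _ _ _ a F) acvg _; exact: cFt.
have c1 : (\int[mu]_(s in `[a n, A]) (r_ker (t - s))%:E)%E @[n --> \oo] -->
   (\int[mu]_(s in \bigcup_n `[a n, A]%classic) (r_ker (t - s))%:E)%E.
  apply: (@ge0_nondecreasing_set_cvg_integral _ _ R).
  - apply/nondecreasing_seqP => n; rewrite subsetEset; apply: subset_itvr.
    rewrite bnd_simp /a lerD2l; apply: ler_wpM2l; first by rewrite subr_ge0 ltW.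
    by rewrite lef_pV2 ?posrE// ler_nat.
  - by move=> n; exact: measurable_itv.
  - by move=> n; apply/measurable_EFinP; apply: measurable_funS (measurable_r_ker t).
  - by move=> n x _; rewrite lee_fin r_ker_ge0.
have E1 : (\int[mu]_(s in \bigcup_n `[a n, A]%classic) (r_ker (t - s))%:E =
    \int[mu]_(s in `]-oo, A]) (r_ker (t - s))%:E)%E.
  rewrite integral_mkcond [RHS]integral_mkcond; apply: eq_integral => s _.
  rewrite !patchE; have [ts|st] := ltP t s; last first.
    have -> : r_ker (t - s) = 0 by rewrite /r_ker subr_lt0 ltNge st.
    by do 2 case: ifP.
  have -> // : (s \in \bigcup_n `[a n, A]%classic) = (s \in `]-oo, A]%classic).
  apply/idP/idP; rewrite !inE/=.
    by move=> [n _] /=; rewrite !in_itv/= => /andP[].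
  rewrite in_itv/= => sA.
  have /cvgr_lt/(_ _ ts)[n _ Hn] := acvg.
  by exists n => //=; rewrite in_itv/= sA andbT ltW//; apply: Hn => /=.
rewrite -E1; apply/esym; rewrite -(cvg_lim _ c1)//; apply/esym/cvg_lim => //.
under eq_fun do rewrite FTC//.
apply: cvg_EFin; first by apply: nearW.
rewrite (_ : 4 / 3 * _ * _ = F A - F t); last by rewrite /F subrr sqrtr0 mulr0 subr0.
apply: cvgB; first exact: cvg_cst.
exact: cc.
Unshelve. all: by end_near. Qed.

End Kernel.

(** * Step functions below and above [g], and their convolutions *)

Section StepBounds.
Context {R : realType}.
Local Notation mu := (@lebesgue_measure R).
Variable z : R -> \bar R.
Hypothesis z_ge0 : forall x : R, 0 <= x -> (0 <= z x)%E.
Hypothesis z_noninc : nonincreasing0 z.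
Implicit Types (v K : nat -> R) (s t x y : R).

Lemma c_ofE x : c_of z x = (z x * x%:E)%E.
Proof. by rewrite /c_of; case: eqP => // ->; rewrite mule0. Qed.

Lemma c_of_ge0 x : 0 <= x -> (0 <= c_of z x)%E.
Proof. by move=> x0; rewrite c_ofE mule_ge0// ?z_ge0// lee_fin. Qed.

Lemma measurable_z_comp (f : R -> R) : measurable_fun setT f -> (forall x, 0 <= f x) ->
  measurable_fun setT (z \o f).
Proof.
move=> mf f0.
(* [z] is monotone only on the half-line; freezing it at [z 0] for negative arguments gives a
   monotone function on the whole line. *)
have mz : measurable_fun setT (fun x : R => z (Num.max 0 x)).
  apply: nonincreasing_emeasurable => x y xy; apply: z_noninc.
    by rewrite le_max lexx.
  by rewrite ge_max !le_max lexx/= xy orbT.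
rewrite (_ : z \o f = (fun x : R => z (Num.max 0 x)) \o f).
  exact: measurableT_comp.
by apply/funext => x /=; rewrite max_r.
Qed.

Lemma measurable_c_of (f : R -> R) : measurable_fun setT f ->
  measurable_fun setT (fun x => c_of z `|f x|).
Proof.
move=> mf; have maf : measurable_fun setT (fun x => `|f x|) by exact: measurableT_comp.
rewrite (_ : (fun x => _) = (fun x => (z \o (fun x => `|f x|%R)) x * (`|f x|%R)%:E)%E).
  by apply: emeasurable_funM; [exact: measurable_z_comp|exact/measurable_EFinP].
by apply/funext => x; rewrite c_ofE.
Qed.

Lemma gen_inv_ge0 s : (0 <= gen_inv z s)%E.
Proof. by apply: le_ereal_inf_tmp => _ [y [y0 _] <-]; rewrite lee_fin. Qed.

Lemma gen_inv_ge s y : 0 <= y -> (s%:E < z y)%E -> (y%:E <= gen_inv z s)%E.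
Proof.
move=> y0 sz; apply: le_ereal_inf_tmp => _ [x [x0 zx] <-]; rewrite lee_fin leNgt.
apply/negP => xy; have := z_noninc x0 (ltW xy).
by rewrite leNgt (le_lt_trans zx sz).
Qed.

Lemma gen_inv_le s y : 0 <= y -> (z y <= s%:E)%E -> (gen_inv z s <= y%:E)%E.
Proof. by move=> y0 zs; apply: ereal_inf_lbound; exists y. Qed.

Lemma measurable_g_of : measurable_fun setT (g_of z).
Proof.
have mg : measurable_fun setT (gen_inv z).
  apply: nonincreasing_emeasurable => x y xy; apply: ereal_inf_le_tmp.
  move=> _ [u [u0 zu] <-]; exists u => //; split => //.
  by apply: le_trans zu _; rewrite lee_fin.
exact: (measurableT_comp (measurable_poweR _) mg).
Qed.

Lemma g_of_ge0 s : (0 <= g_of z s)%E. Proof. exact: poweR_ge0. Qed.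

Lemma poweR_sqr32 x : 0 <= x -> (((x ^+ 2)%:E `^ (3 / 2)) = (x ^+ 3)%:E)%E.
Proof.
move=> x0; rewrite poweR_EFin; congr EFin.
rewrite -[x ^+ 2]powR_mulrn// -powRrM (_ : 2%:R * (3 / 2) = 3%:R :> R); last by field.
by rewrite powR_mulrn.
Qed.

Lemma g_of_ge s x : 0 <= x -> (s%:E < z (x ^+ 2))%E -> ((x ^+ 3)%:E <= g_of z s)%E.
Proof.
move=> x0 sz; rewrite -poweR_sqr32//; apply: gt0_ler_poweR; rewrite ?divr_ge0//.
- by rewrite in_itv/= lee_fin sqr_ge0 leey.
- by rewrite in_itv/= gen_inv_ge0 leey.
- by apply: gen_inv_ge => //; exact: sqr_ge0.
Qed.

Lemma g_of_le s x : 0 <= x -> (z (x ^+ 2) <= s%:E)%E -> (g_of z s <= (x ^+ 3)%:E)%E.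
Proof.
move=> x0 sz; rewrite -poweR_sqr32//; apply: gt0_ler_poweR; rewrite ?divr_ge0//.
- by rewrite in_itv/= gen_inv_ge0 leey.
- by rewrite in_itv/= lee_fin sqr_ge0 leey.
- by apply: gen_inv_le => //; exact: sqr_ge0.
Qed.

(* Levels are written as squares [v ^+ 2], so that the power 3/2 of a level is
   the cube [v ^+ 3]. *)
Lemma steps_le_g v K n s : 0 <= v 0%N -> {homo v : i j / (i <= j)%N >-> i <= j} ->
  (forall j, (j < n)%N -> ((K j)%:E <= z (v j.+1 ^+ 2))%E) ->
  ((\sum_(j < n) (v j.+1 ^+ 3 - v j ^+ 3) * (s < K j)%R%:R)%:E <= g_of z s)%E.
Proof.
move=> v0 vnd; have vge j : 0 <= v j by apply: le_trans v0 _; exact: vnd.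
have v3 j : v j ^+ 3 <= v j.+1 ^+ 3 by rewrite lerXn2r ?nnegrE//; exact: vnd.
have bound m : \sum_(j < m) (v j.+1 ^+ 3 - v j ^+ 3) * (s < K j)%R%:R <= v m ^+ 3.
  elim: m => [|m IH]; first by rewrite big_ord0 exprn_ge0.
  rewrite big_ord_recr/=; case: (s < K m); rewrite ?mulr1 ?mulr0 ?addr0.
    by have := IH; lra.
  exact: le_trans IH (v3 m).
elim: n => [_|n IH HK]; first by rewrite big_ord0 g_of_ge0.
(* If [s < K n], then [z] exceeds [s] at the top level, and the cube of that level already bounds
   the telescoping sum. Otherwise the last step contributes nothing. *)
have [sK|Ks] := ltP s (K n).
  apply: le_trans (g_of_ge (vge n.+1) _); first by rewrite lee_fin.
  by apply: lt_le_trans (HK n _); rewrite ?lte_fin.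
rewrite big_ord_recr/= (ltNge s) Ks mulr0 addr0; apply: IH => j jn.
by apply: HK; exact: ltnW.
Qed.

(** If [K n <= s], the level [v n.+1] is admissible in the generalized inverse and alone bounds [g];
    otherwise the new step compensates the drop from [v n ^+ 3] to [v n.+1 ^+ 3]. The remainder
    [v n ^+ 3] covers the levels not yet used. *)
Lemma g_le_steps v K n s : (forall j, 0 <= v j) ->
  {homo v : i j / (i <= j)%N >-> j <= i} ->
  (z (v 0%N ^+ 2) <= s%:E)%E -> (forall j, (z (v j.+1 ^+ 2) <= (K j)%:E)%E) ->
  (g_of z s <= (v n ^+ 3 + \sum_(j < n) (v j ^+ 3 - v j.+1 ^+ 3) * (s < K j)%R%:R)%:E)%E.
Proof.
move=> v0 vni zv HK.
have v3 j : v j.+1 ^+ 3 <= v j ^+ 3 by rewrite lerXn2r ?nnegrE//; exact: vni.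
elim: n => [|n IH]; first by rewrite big_ord0 addr0; exact: g_of_le.
have [sK|Ks] := ltP s (K n).
  apply: le_trans IH _; rewrite lee_fin big_ord_recr/= sK mulr1; lra.
apply: (@le_trans _ _ (v n.+1 ^+ 3)%:E).
  apply: g_of_le => //; apply: le_trans (HK n) _; by rewrite lee_fin.
rewrite lee_fin lerDl sumr_ge0// => j _.
by rewrite mulr_ge0// subr_ge0.
Qed.

(** One layer of a layer-cake decomposition of [g]. For [K0 <= t] both sides are 0, because the
    square root of a nonpositive number is 0. *)
Lemma integral_step_kernel (t K0 a : R) : 0 <= a ->
  (\int[mu]_s (a * (s < K0)%R%:R * r_ker (t - s))%:E =
    (a * (4 / 3 * Num.sqrt 2 * Num.sqrt (K0 - t)))%:E)%E.
Proof.
move=> a0; rewrite EFinM -integral_r_ker -integral_itv_bndo_bndc; last first.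
  by apply/measurable_EFinP; exact: measurable_funS (measurable_r_ker t).
rewrite -ge0_integralZl_EFin//; last 2 first.
  by move=> s _; rewrite lee_fin r_ker_ge0.
  by apply/measurable_EFinP; exact: measurable_funS (measurable_r_ker t).
rewrite [RHS]integral_mkcond; apply: eq_integral => s _; rewrite patchE.
have -> : (s \in `]-oo, K0[%classic) = (s < K0) by apply/idP/idP; rewrite inE/= in_itv.
by case: ifP => _; rewrite ?mulr1 ?mulr0 ?mul0r// EFinM.
Qed.

Lemma measurable_step_kernel (t K0 a : R) :
  measurable_fun setT (fun s => a * (s < K0)%R%:R * r_ker (t - s)).
Proof.
apply: measurable_funM; last exact: measurable_r_ker.
apply: measurable_funM => //.
rewrite (_ : (fun s => _) = \1_`]-oo, K0[%classic :> (R -> R)).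
  exact: measurable_indic.
apply/funext => s; rewrite indicE (_ : (s \in _) = (s < K0))//.
by apply/idP/idP; rewrite inE/= in_itv.
Qed.

Lemma steps_le_convol v K n t : 0 <= v 0%N ->
  {homo v : i j / (i <= j)%N >-> i <= j} ->
  (forall j, (j < n)%N -> ((K j)%:E <= z (v j.+1 ^+ 2))%E) ->
  ((\sum_(j < n) (v j.+1 ^+ 3 - v j ^+ 3) * (4 / 3 * Num.sqrt 2 * Num.sqrt (K j - t)))%:E
    <= convol (g_of z) (@r_ker R) t)%E.
Proof.
move=> v0 vnd HK; have vge j : 0 <= v j by apply: le_trans v0 _; exact: vnd.
have v3 j : 0 <= v j.+1 ^+ 3 - v j ^+ 3.
  by rewrite subr_ge0 lerXn2r ?nnegrE//; exact: vnd.
rewrite -sumEFin; under eq_bigr do rewrite -integral_step_kernel//.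
rewrite -ge0_integral_sum//; last 2 first.
  by move=> j; apply/measurable_EFinP; exact: measurable_step_kernel.
  by move=> j s _; rewrite lee_fin !mulr_ge0// r_ker_ge0.
rewrite /convol; apply: ge0_le_integral => //.
- by move=> s _; apply: sume_ge0 => j _; rewrite lee_fin !mulr_ge0// r_ker_ge0.
- apply: emeasurable_sum => j; apply/measurable_EFinP; exact: measurable_step_kernel.
- apply: emeasurable_funM; first exact: measurable_g_of.
  by apply/measurable_EFinP; exact: measurable_r_ker.
- move=> s _; rewrite sumEFin -mulr_suml EFinM lee_wpmul2r ?lee_fin ?r_ker_ge0//.
  exact: steps_le_g.
Qed.

(** The kernel charges only [s > s0], and there [z (v 0 ^+ 2) <= s0] makes the top level admissible.
    As [v n] tends to 0 the remainder in [g_le_steps] disappears, and the resulting series of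
    nonnegative steps is integrated term by term. *)
Lemma convol_le_steps v K (s0 B : R) : (forall j, 0 <= v j) ->
  {homo v : i j / (i <= j)%N >-> j <= i} -> v n @[n --> \oo] --> 0 ->
  (z (v 0%N ^+ 2) <= s0%:E)%E -> (forall j, (z (v j.+1 ^+ 2) <= (K j)%:E)%E) ->
  (forall n, \sum_(j < n) (v j ^+ 3 - v j.+1 ^+ 3) *
    (4 / 3 * Num.sqrt 2 * Num.sqrt (K j - s0)) <= B) ->
  (convol (g_of z) (@r_ker R) s0 <= B%:E)%E.
Proof.
move=> v0 vni vcvg zv HK HB.
have v3 j : 0 <= v j ^+ 3 - v j.+1 ^+ 3.
  by rewrite subr_ge0 lerXn2r ?nnegrE//; exact: vni.
pose F j s := ((v j ^+ 3 - v j.+1 ^+ 3) * (s < K j)%R%:R * r_ker (s0 - s))%:E.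
have F0 j s : (0 <= F j s)%E by rewrite lee_fin !mulr_ge0// r_ker_ge0.
have mF j : measurable_fun setT (F j).
  by apply/measurable_EFinP; exact: measurable_step_kernel.
apply: (@le_trans _ _ (\int[mu]_s \sum_(0 <= j <oo) F j s)%E).
  rewrite /convol; apply: ge0_le_integral => //.
  - by move=> s _; rewrite mule_ge0 ?g_of_ge0// lee_fin r_ker_ge0.
  - apply: emeasurable_funM; first exact: measurable_g_of.
    by apply/measurable_EFinP; exact: measurable_r_ker.
  - by apply: ge0_emeasurable_sum => *; [exact: F0|exact: mF].
  - move=> s _; have [ss0|s0s] := leP s s0.
      have -> : r_ker (s0 - s) = 0 by rewrite /r_ker subr_lt0 ltNge ss0.
      by rewrite mule0; apply: nneseries_ge0 => j _ _; exact: F0.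
    have zs : (z (v 0%N ^+ 2) <= s%:E)%E by apply: le_trans zv _; rewrite lee_fin ltW.
    have H n := g_le_steps n v0 vni zs HK.
    have c0 : ((v n ^+ 3 * r_ker (s0 - s))%:E + \sum_(0 <= j <oo) F j s)%E @[n --> \oo] -->
        (0 + \sum_(0 <= j <oo) F j s)%E.
      apply: cvgeD; [by rewrite fin_num_adde_defr| |exact: cvg_cst].
      apply: cvg_EFin; first exact: nearW.
      rewrite -[X in _ --> X](mul0r (r_ker (s0 - s))); apply: cvgMl.
      have -> : (fun n => v n ^+ 3) = (fun n => v n * (v n * v n)).
        by apply/funext => n; rewrite !exprS expr0 mulr1.
      rewrite [X in _ --> X](_ : 0 = 0 * (0 * 0) :> R); last by rewrite !mulr0.
      by apply: cvgM => //; exact: cvgM.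
    rewrite -[leRHS]add0e -(cvg_lim _ c0)//; apply: lime_ge.
      by apply/cvg_ex; eexists; exact: c0.
    apply: nearW => n.
    apply: (@le_trans _ _ ((v n ^+ 3 + \sum_(j < n) (v j ^+ 3 - v j.+1 ^+ 3) * (s < K j)%R%:R)%:E
       * (r_ker (s0 - s))%:E)%E).
      by rewrite lee_wpmul2r// lee_fin r_ker_ge0.
    rewrite -EFinM mulrDl EFinD leeD2l// mulr_suml -sumEFin.
    rewrite -(big_mkord xpredT (F^~ s)).
    by apply: nneseries_lim_ge => j _ _; exact: F0.
rewrite integral_nneseries//.
apply: lime_le; first by apply: is_cvg_nneseries => j _ _; exact: integral_ge0.
apply: nearW => n; rewrite big_mkord.
under eq_bigr do rewrite /F integral_step_kernel//.
by rewrite sumEFin lee_fin.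
Qed.

End StepBounds.

(** * Energy cost of crossing a band of levels *)

Section Bands.
Context {R : realType}.
Local Notation mu := (@lebesgue_measure R).
Variables (f D : R -> R) (e : R -> \bar R).
Hypotheses (acf : ac_on setT f D) (mD : measurable_fun setT D).
Hypotheses (me : measurable_fun setT e) (e0 : forall x, (0 <= e x)%E).

Lemma young_sqrt (d k : R) : 0 <= k -> Num.sqrt (2 * k) * `|d| <= 2^-1 * d ^+ 2 + k.
Proof.
move=> k0; have k2 : 0 <= 2 * k by rewrite mulr_ge0.
have := sqr_sqrtr k2; rewrite -(real_normK (num_real d)).
set r := Num.sqrt _; have := sqr_ge0 (r - `|d|); nra.
Qed.

(** By Young's inequality the density dominates [sqrt(2 k) |D|] while [f] runs strictly between [b]
    and [a]. From the last point with [f >= a] to the first later one with [f <= b] this holds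
    throughout, and the integral of [|D|] is at least the drop [a - b]. *)
Lemma one_band (p q a b k : R) : p <= q -> a <= f p -> f q <= b -> b < a -> 0 <= k ->
  (forall x, b < f x < a -> ((2^-1 * D x ^+ 2 + k)%:E <= e x)%E) ->
  ((Num.sqrt (2 * k) * (a - b))%:E <= \int[mu]_(x in `[p, q]) e x)%E.
Proof.
move=> pq ap qb ba k0 He.
have cf := ac_continuous acf.
have [u /andP[pu uq] [au Hu]] := last_ge cf pq ap.
(* The first point with [f <= b] is the last point above [- b] of the function negated and run
   backwards. *)
have cg : continuous (fun x => - f (0 - x)).
  move=> x; apply: cvgN; apply: (@continuous_comp _ _ _ (fun x : R => 0 - x)); last exact: cf.
  by apply: cvgB; [exact: cvg_cst|].
have uq' : - q <= - u by rewrite lerN2.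
have [|w /andP[qw wu] [bw Hw]] := @last_ge _ _ _ _ (- b) cg uq'.
  by rewrite sub0r opprK lerN2.
pose v := - w.
have fv : f v <= b by rewrite -lerN2 /v; move: bw; rewrite sub0r.
have uv : u <= v by rewrite /v lerNr.
have vq : v <= q by rewrite /v lerNl.
have Hv x : u <= x -> x < v -> b < f x.
  move=> ux xv; have := Hw (- x); rewrite sub0r opprK ltrN2; apply.
    by rewrite ltrNr.
  by rewrite lerN2.
have [iD fE] := acf I I uv.
have mDuv : measurable_fun `]u, v[ (EFin \o D).
  by apply/measurable_EFinP; exact: measurable_funS mD.
apply: (@le_trans _ _ (\int[mu]_(x in `]u, v[) e x)%E); last first.
  apply: ge0_subset_integral => //; first exact: measurable_funS me.
  by apply: subset_itv; rewrite bnd_simp.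
apply: (@le_trans _ _ (\int[mu]_(x in `]u, v[)
    ((Num.sqrt (2 * k))%:E * `|(D x)%:E|))%E); last first.
  apply: ge0_le_integral => //.
  - by apply: measurable_funeM; exact: measurableT_comp.
  - exact: measurable_funS me.
  - move=> x /=; rewrite in_itv/= => /andP[ux xv]; apply: le_trans (He x _).
      by rewrite lee_fin young_sqrt.
    by rewrite Hv ?(ltW ux)//= Hu// (le_trans (ltW xv)).
rewrite ge0_integralZl_EFin//; last exact: measurableT_comp.
rewrite EFinM lee_wpmul2l ?lee_fin ?sqrtr_ge0//.
apply: (@le_trans _ _ `|\int[mu]_(x in `]u, v[) (D x)%:E|%E); last exact: le_abse_integral.
rewrite -(@integral_itv_bndoo _ u v _ true false)// -fE /= lee_fin.
rewrite -normrN opprB (le_trans _ (ler_norm _))//; lra.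
Qed.

(** The intermediate value theorem gives a point [c] at the next-to-last level; the first [n] bands
    are charged to [[p, c]] and the last one to [[c, q]], so no part of the energy is counted
    twice. *)
Lemma bands (a k : nat -> R) n p q : p <= q -> a 0%N <= f p -> f q <= a n ->
  (forall j, a j.+1 < a j) -> (forall j, 0 <= k j) ->
  (forall j x, (j < n)%N -> a j.+1 < f x < a j -> ((2^-1 * D x ^+ 2 + k j)%:E <= e x)%E) ->
  ((\sum_(j < n) Num.sqrt (2 * k j) * (a j - a j.+1))%:E <= \int[mu]_(x in `[p, q]) e x)%E.
Proof.
move=> pq + + ani k0; elim: n q pq => [|n IH] q pq ap qa He.
  by rewrite big_ord0; exact: integral_ge0.
have a0n : a n <= a 0%N.
  by have /nonincreasing_seqP := fun j => ltW (ani j); apply.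
have cf : {within `[p, q], continuous f}.
  by apply: continuous_subspaceT; exact: ac_continuous acf.
have [|c] := @IVT _ f p q (a n) pq cf.
  rewrite ge_min le_max (le_trans a0n ap)/= orbC.
  by rewrite (le_trans qa) ?orbT// ltW.
rewrite in_itv/= => /andP[pc cq] fc.
rewrite big_ord_recr/= EFinD (ge0_integral_itv_split pc cq)//.
apply: leeD.
  apply: IH => //; first by rewrite fc.
  by move=> j x jn; apply: He; exact: ltnW.
apply: one_band => //; first by rewrite fc.
by move=> x; exact: He.
Qed.

End Bands.

Section BandsLeft.
Context {R : realType}.
Local Notation mu := (@lebesgue_measure R).

Lemma bands_left (f D : R -> R) (e : R -> \bar R) (a k : nat -> R) n p q :
  ac_on setT f D -> measurable_fun setT D ->
  measurable_fun setT e -> (forall x, (0 <= e x)%E) ->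
  q <= p -> a 0%N <= f p -> f q <= a n ->
  (forall j, a j.+1 < a j) -> (forall j, 0 <= k j) ->
  (forall j x, (j < n)%N -> a j.+1 < f x < a j -> ((2^-1 * D x ^+ 2 + k j)%:E <= e x)%E) ->
  ((\sum_(j < n) Num.sqrt (2 * k j) * (a j - a j.+1))%:E <= \int[mu]_(x in `[q, p]) e x)%E.
Proof.
move=> acf mD me e0 qp ap qa ani k0 He.
rewrite (ge0_integral_reflect 0 (measurable_itv _) me e0) preimage_reflect_itvcc.
have refl (x : R) : 0 - (0 - x) = x by ring.
apply: (@bands _ (fun x => f (0 - x)) (fun x => - D (0 - x)) (fun x => e (0 - x)%R)).
- have := ac_on_reflect (c := 0) mD acf; rewrite preimage_setT; exact.
- apply: measurableT_comp => //; exact: (measurableT_comp mD (measurable_reflection 0)).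
- exact: (measurableT_comp me (measurable_reflection 0)).
- by move=> x; exact: e0.
- by rewrite lerD2l lerN2.
- by rewrite refl.
- by rewrite refl.
- exact: ani.
- exact: k0.
- by move=> j x jn H; rewrite sqrrN; exact: He.
Qed.

End BandsLeft.

(** * Lower bound for the energy of a single profile *)

Section LowerBound.
Context {R : realType}.
Local Notation mu := (@lebesgue_measure R).
Variable z : R -> \bar R.
Hypothesis z_ge0 : forall x : R, 0 <= x -> (0 <= z x)%E.
Hypothesis z_noninc : nonincreasing0 z.

Lemma integrable_small (f : R -> R) (w a b r : R) : measurable_fun setT f ->
  (forall x, 0 <= f x) -> (\int[mu]_x (f x)%:E = w%:E)%E -> a <= b -> 0 < r ->
  w < r * (b - a) -> exists2 x, a <= x <= b & f x <= r.
Proof.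
move=> mf f0 fw ab r0 wr; apply: contrapT => H.
have fr x : a <= x <= b -> r <= f x.
  by move=> xab; rewrite leNgt; apply/negP => fx; apply: H; exists x => //; exact: ltW.
have : ((r * (b - a))%:E <= w%:E)%E.
  rewrite -fw; apply: (@le_trans _ _ (\int[mu]_(x in `[a, b]) (f x)%:E)%E); last first.
    by apply: ge0_subset_integral => //; [exact/measurable_EFinP|move=> x _; rewrite lee_fin].
  apply: (@le_trans _ _ (\int[mu]_(x in `[a, b]) (cst r%:E x))%E).
    rewrite integral_cst//= lebesgue_measure_itv/= lte_fin.
    move: ab; rewrite le_eqVlt => /predU1P[->|ab]; last by rewrite ab -EFinB -EFinM.
    by rewrite ltxx subrr mulr0 mule0.
  apply: ge0_le_integral => //.
  - by move=> x _; rewrite lee_fin ltW.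
  - by apply/measurable_EFinP; exact: measurable_funS mf.
by rewrite lee_fin leNgt wr.
Qed.

(** Energy bands lie one level below the steps of [g], since [z >= K j] is known only below the
    level at which [K j] is read off; this shift costs [l ^+ 3]. Taking [sqrt h] at the lower end of
    the band costs at most another [l], because [l ^+ 3 - 3 * l + 2 = (l - 1) ^+ 2 * (l + 2)]. *)
Lemma band_cost_le (l u c : R) : 1 <= l -> 0 <= u -> 0 <= c ->
  ((l * (l * u)) ^+ 3 - (l * u) ^+ 3) * (4 / 3 * c) <=
  l ^+ 4 * (2 * (c * u * ((l * u) ^+ 2 - u ^+ 2))).
Proof.
move=> l1 u0 c0; rewrite -subr_ge0.
have -> : l ^+ 4 * (2 * (c * u * ((l * u) ^+ 2 - u ^+ 2))) -
    ((l * (l * u)) ^+ 3 - (l * u) ^+ 3) * (4 / 3 * c) =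
    2 / 3 * (l ^+ 3 * (c * u ^+ 3)) * ((l - 1) ^+ 2 * (l + 2)) by field.
have l0 : 0 <= l by exact: le_trans l1.
apply: mulr_ge0; last by apply: mulr_ge0; [exact: sqr_ge0|rewrite addr_ge0].
apply: mulr_ge0; first by rewrite divr_ge0.
by apply: mulr_ge0; [exact: exprn_ge0|apply: mulr_ge0 => //; exact: exprn_ge0].
Qed.

Lemma expr4_le_add (X eps : R) : 0 <= X -> 0 < eps ->
  exists2 l, 1 < l & l ^+ 4 * X <= X + eps.
Proof.
move=> X0 eps0; pose d := Num.min 1 (eps / (15 * X + 1)).
have X15 : 0 < 15 * X + 1 by rewrite ltr_pwDr// mulr_ge0.
have d0 : 0 < d by rewrite lt_min ltr01 divr_gt0.
have d1 : d <= 1 by rewrite ge_min lexx.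
have dX : d * (15 * X + 1) <= eps by rewrite -ler_pdivlMr// ge_min lexx orbT.
exists (1 + d); first by rewrite ltrDl.
have d4 : (1 + d) ^+ 4 <= 1 + 15 * d.
  have d2 : d ^+ 2 <= d by rewrite expr2 ger_pMl.
  have d3 : d ^+ 3 <= d by rewrite exprSr ger_pMl// (le_trans d2).
  have d4' : d ^+ 4 <= d by rewrite exprSr ger_pMl// (le_trans d3).
  have -> : (1 + d) ^+ 4 = 1 + 4 * d + 6 * d ^+ 2 + 4 * d ^+ 3 + d ^+ 4 by ring.
  lra.
apply: (@le_trans _ _ ((1 + 15 * d) * X)); first by rewrite ler_wpM2r.
nra.
Qed.

(* The multiplier is [s = z (sup f)]. Subtracting [s * f] from the density, each side
   of a maximum still has to cross the levels [l^-2j * sup f], and by Young's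
   inequality these crossings cost the steps of a Riemann sum for the convolution. *)
Lemma energy_lower_bound (f D : R -> R) (w : R) : ac_on setT f D ->
  measurable_fun setT D -> (forall x, 0 <= f x) -> 0 < w ->
  (\int[mu]_x (f x)%:E = w%:E)%E ->
  (\int[mu]_x ((2^-1 * D x ^+ 2)%:E + c_of z `|f x|) < +oo)%E ->
  exists2 s, 0 <= s & (convol (g_of z) (@r_ker R) s + (s * w)%:E <=
    \int[mu]_x ((2^-1 * D x ^+ 2)%:E + c_of z `|f x|))%E.
Proof.
move=> acf mD f0 w0 fw; set E := (\int[mu]_x _)%E => Eoo.
have cf := ac_continuous acf.
have mf : measurable_fun setT f by exact: continuous_measurable_fun.
have absf x : `|f x| = f x by rewrite ger0_norm.
have mD2 : measurable_fun setT (fun x => (2^-1 * D x ^+ 2)%:E).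
  by apply/measurable_EFinP; apply: measurable_funM => //; exact: measurable_funX.
have D20 x : (0 <= (2^-1 * D x ^+ 2)%:E)%E by rewrite lee_fin mulr_ge0// sqr_ge0.
have mc := measurable_c_of z_noninc mf.
have c0 x : (0 <= c_of z `|f x|)%E by exact: c_of_ge0.
have mfE : measurable_fun setT (fun x => (f x)%:E) by exact/measurable_EFinP.
have f0E x : (0 <= (f x)%:E)%E by rewrite lee_fin.
have E0 : (0 <= E)%E by apply: integral_ge0 => x _; rewrite adde_ge0.
have Efin : E \is a fin_num by rewrite ge0_fin_numE.
have smallR p r : 0 < r -> exists2 q, p <= q & f q <= r.
  move=> r0; have [] := @integrable_small f w p (p + (w + 1) / r) r mf f0 fw _ r0.
  - by rewrite lerDl divr_ge0 ?addr_ge0 ?ltW.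
  - by rewrite addrAC subrr add0r mulrC divfK ?gt_eqF// ltrDl.
  - by move=> q /andP[pq _] fq; exists q.
have smallL p r : 0 < r -> exists2 q, q <= p & f q <= r.
  move=> r0; have [] := @integrable_small f w (p - (w + 1) / r) p r mf f0 fw _ r0.
  - by rewrite gerBl divr_ge0 ?addr_ge0 ?ltW.
  - by rewrite opprB addrCA subrr addr0 mulrC divfK ?gt_eqF// ltrDl.
  - by move=> q /andP[_ pq] fq; exists q.
(* A crude bound that makes [sup f] meaningful: adding [f] to the kinetic term gives a density of
   integral at most [E + w], and [f >= 1/2] above the level [1/2], where [sqrt(2 * 1/2) = 1]. *)
have fbound p : f p <= 2^-1 + fine E + w.
  have Ew : 0 <= fine E + w by rewrite addr_ge0// ?fine_ge0// ltW.
  have [fp|fp] := leP (f p) 2^-1; first by lra.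
  have [q pq fq] := smallR p 2^-1 (ltac:(by rewrite invr_gt0)).
  pose e1 x := ((2^-1 * D x ^+ 2)%:E + (f x)%:E)%E.
  have me1 : measurable_fun setT e1 by exact: emeasurable_funD.
  have e10 x : (0 <= e1 x)%E by rewrite adde_ge0.
  have := @one_band _ f D e1 acf mD me1 e10 p q (f p) 2^-1 2^-1 pq (lexx _) fq fp
    (ltac:(by rewrite invr_ge0)).
  rewrite divff// sqrtr1 mul1r => H.
  have : ((f p - 2^-1)%:E <= (fine E + w)%:E)%E.
    apply: le_trans (H _) _.
      by move=> x /andP[hx _]; rewrite /e1 -EFinD lee_fin lerD2l ltW.
    apply: (@le_trans _ _ (\int[mu]_x e1 x)%E).
      by apply: ge0_subset_integral.
    rewrite ge0_integralD// fw EFinD fineK// leeD2r//.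
    apply: ge0_le_integral => //; first exact: emeasurable_funD.
    by move=> x _; rewrite leeDl.
  by rewrite lee_fin; lra.
pose S := range f.
have supS : has_sup S.
  split; first by exists (f 0), 0.
  by exists (2^-1 + fine E + w) => _ [x _ <-].
pose H := sup S.
have fH x : f x <= H by apply: ub_le_sup; [case: supS|exists x].
have nearH h : h < H -> exists p, h <= f p.
  move=> hH; have [_ [p _ <-] hp] := sup_adherent
    (ltac:(by rewrite subr_gt0; exact: hH) : 0 < H - h) supS.
  exists p; rewrite subKr in hp; exact: ltW.
have H0 : 0 < H.
  rewrite ltNge; apply/negP => H0.
  have : (\int[mu]_x (f x)%:E = 0)%E.
    apply: integral0_eq => x _; congr EFin; apply/eqP; rewrite eq_le f0 andbT.
    exact: le_trans (fH x) H0.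
  by rewrite fw => -[] w00; rewrite w00 ltxx in w0.
(* Since [f <= H], monotonicity gives [z (f x) >= z H] everywhere. With [w > 0] and [E] finite this
   makes the multiplier [z H] a real number. *)
have zHw : (z H * w%:E <= E)%E.
  rewrite -fw -ge0_integralZl//; last by apply: z_ge0; exact: ltW.
  apply: ge0_le_integral => //.
  - by move=> x _; rewrite mule_ge0// z_ge0// ltW.
  - exact: measurable_funeM.
  - exact: emeasurable_funD.
  - move=> x _; rewrite absf c_ofE; apply: (@le_trans _ _ (z (f x) * (f x)%:E)%E).
      by rewrite lee_wpmul2r//; exact: z_noninc.
    by rewrite leeDr.
have zHfin : z H \is a fin_num.
  rewrite ge0_fin_numE ?z_ge0 ?ltW// lt_neqAle leey andbT; apply/eqP => zH.
  by move: zHw; rewrite zH mulyr gtr0_sg// mul1e leye_eq => /eqP EE; rewrite EE in Eoo.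
pose s := fine (z H).
have sE : z H = s%:E by rewrite fineK.
have s0 : 0 <= s by rewrite fine_ge0// z_ge0// ltW.
have zs x : (0 <= z (f x) - s%:E)%E by rewrite -sE sube_ge0 ?zHfin//; exact: z_noninc.
pose e x := ((2^-1 * D x ^+ 2)%:E + (z (f x) - s%:E) * (f x)%:E)%E.
have e0 x : (0 <= e x)%E by rewrite adde_ge0// mule_ge0.
have mz : measurable_fun setT (fun x => z (f x)) by exact: measurable_z_comp.
have me : measurable_fun setT e.
  apply: emeasurable_funD => //; apply: emeasurable_funM => //.
  exact: emeasurable_funB.
pose X := (\int[mu]_x e x)%E.
(* Where [z (f x) = +oo] the identity of densities still holds: at [f x = 0] both products are 0,
   and for [f x > 0] both sides are infinite. *)
have EX : (E = X + (s * w)%:E)%E.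
  rewrite EFinM -fw -ge0_integralZl_EFin// -ge0_integralD//; last 2 first.
  - by move=> x _; rewrite mule_ge0// lee_fin.
  - exact: measurable_funeM.
  apply: eq_integral => x _; rewrite /e absf c_ofE -addeA; congr (_ + _)%E.
  have := zs x; have zx := z_ge0 (f0 x); case: (z (f x)) zx => [r| |]//= _ _.
    by rewrite -EFinB -!EFinM -EFinD mulrBl subrK.
  have := f0 x; rewrite le_eqVlt => /predU1P[<-|fx]; first by rewrite !mule0 adde0.
  by rewrite addye// !gt0_mulye ?lte_fin// addye.
have X0 : (0 <= X)%E by exact: integral_ge0.
have Xfin : X \is a fin_num.
  rewrite ge0_fin_numE//; apply: le_lt_trans Eoo; rewrite EX leeDl// lee_fin.
  by rewrite mulr_ge0// ltW.
(* If [z h = +oo], crossing the band from [h] to [h / 2] would cost more than any bound; [A] is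
   chosen so that it would cost [X + 1]. *)
have zfin h : 0 < h -> h < H -> z h \is a fin_num.
  move=> h0 hH; rewrite ge0_fin_numE ?z_ge0 ?ltW// lt_neqAle leey andbT; apply/eqP => zh.
  have [p hp] := nearH h hH.
  have h20 : 0 < h / 2 by rewrite divr_gt0.
  have [q pq fq] := smallR p (h / 2) h20.
  pose A : R := (fine X + 1) / (h / 2).
  have A0 : 0 <= A by rewrite divr_ge0// ?addr_ge0 ?fine_ge0// ltW.
  have := @one_band _ f D e acf mD me e0 p q h (h / 2) (A ^+ 2 / 2) pq hp fq
    (ltac:(lra)) (ltac:(by rewrite divr_ge0// sqr_ge0)).
  rewrite (_ : 2 * (A ^+ 2 / 2) = A ^+ 2); last by field.
  rewrite sqrtr_sqr ger0_norm// => HH.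
  have : ((fine X + 1)%:E <= X)%E.
    apply: (@le_trans _ _ (\int[mu]_(x in `[p, q]) e x)%E); last exact: ge0_subset_integral.
    apply: le_trans (HH _).
      rewrite lee_fin /A (_ : h - h / 2 = h / 2); last by field.
      by rewrite divfK// gt_eqF.
    move=> x /andP[hx1 hx2]; rewrite /e (_ : z (f x) = +oo%E).
      by rewrite addye// gt0_mulye ?lte_fin ?(lt_trans h20)// addey// leey.
    by apply/eqP; rewrite -leye_eq -zh; apply: z_noninc; [exact: f0|exact: ltW].
  by rewrite -[X in (_ <= X)%E]fineK// lee_fin; lra.
have main l : 1 < l -> (convol (g_of z) (@r_ker R) s <= (l ^+ 4 * fine X)%:E)%E.
  move=> l1; have l0 : 0 < l by exact: lt_trans l1.
  pose V : R := Num.sqrt H.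
  have V0 : 0 < V by rewrite sqrtr_gt0.
  have V2 : V ^+ 2 = H by rewrite sqr_sqrtr// ltW.
  pose v (j : nat) : R := V * l^-1 ^+ j.
  have li0 : 0 < l^-1 by rewrite invr_gt0.
  have li1 : l^-1 < 1 by rewrite invf_lt1.
  have v0 j : 0 < v j by rewrite mulr_gt0// exprn_gt0.
  have vS j : v j = l * v j.+1.
    by rewrite /v exprS (mulrCA l) mulVKf// gt_eqF.
  have vlt j : v j.+1 < v j by rewrite [ltRHS]vS ltr_pMl.
  have vni : {homo v : i j / (i <= j)%N >-> j <= i}.
    by apply/nonincreasing_seqP => j; exact: ltW.
  have v2lt j : v j.+1 ^+ 2 < v j ^+ 2 by rewrite ltrXn2r// ?nnegrE ltW.
  have v2H j : v j.+1 ^+ 2 < H.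
    apply: (@lt_le_trans _ _ (v j ^+ 2)) => //.
    rewrite -V2 (_ : V = v 0%N); last by rewrite /v expr0 mulr1.
    by apply: lerXn2r; [rewrite nnegrE ltW|rewrite nnegrE ltW|exact: vni].
  pose K j := fine (z (v j.+1 ^+ 2)).
  have KE j : z (v j.+1 ^+ 2) = (K j)%:E by rewrite fineK// zfin// exprn_gt0.
  have Ks j : s <= K j.
    by rewrite -lee_fin -KE -sE; apply: z_noninc; rewrite ?sqr_ge0// ltW.
  apply: (convol_le_steps (v := v) (K := K)) => //.
  - by move=> j; exact: ltW.
  - rewrite -[X in _ --> X](mulr0 V); apply: cvgMr; apply: cvg_expr.
    by rewrite ger0_norm// ltW.
  - by rewrite /v expr0 mulr1 V2 sE.
  - by move=> j; rewrite KE.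
  move=> n.
  (* The bands start at [v 1 ^+ 2 < H], so a point above that level suffices and [sup f] need not be
     shown to be attained. *)
  have [p fp] := nearH (v 1%N ^+ 2) (v2H 0%N).
  have vn0 : 0 < v n.+1 ^+ 2 by rewrite exprn_gt0.
  have [q pq fq] := smallR p _ vn0.
  have [q' qp fq'] := smallL p _ vn0.
  pose a j := v j.+1 ^+ 2.
  pose k j := (K j - s) * v j.+2 ^+ 2.
  have k0 j : 0 <= k j by rewrite mulr_ge0 ?sqr_ge0// subr_ge0.
  have He j x : (j < n)%N -> a j.+1 < f x < a j -> ((2^-1 * D x ^+ 2 + k j)%:E <= e x)%E.
    move=> _ /andP[h1 h2]; rewrite /e EFinD leeD2l// /k EFinM.
    apply: lee_pmul; rewrite ?lee_fin ?subr_ge0 ?sqr_ge0//.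
      rewrite EFinB leeB// -KE; apply: z_noninc => //; exact: ltW.
    exact: ltW.
  have bR := @bands _ f D e acf mD me e0 a k n p q pq fp fq (fun j => v2lt j.+1) k0 He.
  have bL := @bands_left _ f D e a k n p q' acf mD me e0 qp fp fq' (fun j => v2lt j.+1) k0 He.
  set B := \sum_(j < n) Num.sqrt _ * _ in bR bL.
  have BX : 2 * B <= fine X.
    rewrite -lee_fin fineK// mulr_natl mulr2n EFinD.
    apply: (@le_trans _ _ (\int[mu]_(x in `[q', q]) e x)%E); last exact: ge0_subset_integral.
    by rewrite (ge0_integral_itv_split qp pq)// leeD.
  apply: (@le_trans _ _ (l ^+ 4 * (2 * B))); last by rewrite ler_pM2l// exprn_gt0.
  rewrite /B !mulr_sumr; apply: ler_sum => j _.
  rewrite /k sqrtrM// sqrtrM ?subr_ge0// sqrtr_sqr (ger0_norm (ltW (v0 _))) /a.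
  rewrite (vS j) (vS j.+1).
  rewrite -[4 / 3 * _ * _]mulrA [Num.sqrt 2 * (_ * _)]mulrA.
  apply: band_cost_le; [exact: ltW|exact: ltW|by rewrite mulr_ge0 ?sqrtr_ge0].
exists s => //; rewrite EX leeD2r// -[leRHS]fineK//.
have fX0 : 0 <= fine X by rewrite fine_ge0.
apply/lee_addgt0Pr => eps eps0.
have [l l1 lX] := expr4_le_add fX0 eps0.
by apply: le_trans (main l l1) _; rewrite -EFinD lee_fin.
Qed.

End LowerBound.

(** * Competitors and the upper bound for tau *)

Section Competitor.
Context {R : realType}.
Local Notation mu := (@lebesgue_measure R).
Variable z : R -> \bar R.
Hypothesis z_ge0 : forall x : R, 0 <= x -> (0 <= z x)%E.
Hypothesis z_noninc : nonincreasing0 z.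

Definition edens (f D : R -> R) (x : R) : \bar R :=
  ((2^-1 * D x ^+ 2)%:E + c_of z `|f x|)%E.

Lemma edens_ge0 f D x : (0 <= edens f D x)%E.
Proof. by rewrite adde_ge0 ?c_of_ge0// lee_fin mulr_ge0// sqr_ge0. Qed.

Lemma measurable_edens f D : measurable_fun setT f -> measurable_fun setT D ->
  measurable_fun setT (edens f D).
Proof.
move=> mf mD; apply: emeasurable_funD; last exact: measurable_c_of.
by apply/measurable_EFinP; apply: measurable_funM => //; exact: measurable_funX.
Qed.

Lemma ac_on_affine (h p c : R) : ac_on setT (fun x => h + p * (x - c)) (cst p).
Proof.
move=> a b _ _ ab; split.
  by apply: continuous_compact_integrable; [exact: segment_compact|
    apply: continuous_subspaceT => x; exact: cvg_cst].
transitivity (\int[mu]_(x in `[a, b]) cst p%:E x)%E; last by [].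
rewrite integral_cst//= lebesgue_measure_itv/= lte_fin.
move: ab; rewrite le_eqVlt => /predU1P[->|ab]; first by rewrite ltxx subrr mule0.
by rewrite ab -EFinB -EFinM; congr EFin; ring.
Qed.

Lemma measurable_glue (f1 f2 : R -> R) (c : R) :
  measurable_fun setT f1 -> measurable_fun setT f2 ->
  measurable_fun setT (fun x : R => if x <= c then f1 x else f2 x).
Proof. by move=> m1 m2; apply: measurable_fun_ifT => //; exact: measurable_fun_ler. Qed.

(** Slope times height gain for the climb from [u ^+ 2] to [(l * u) ^+ 2]: the slope is
    [sqrt(2 (z - t) h)] with [z] read at the bottom of the band and [h] at its top. *)
Definition band_cost (t l u : R) : R :=
  Num.sqrt 2 * Num.sqrt (fine (z (u ^+ 2)) - t) * (l * (l ^+ 2 - 1)) * u ^+ 3.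

Lemma band_cost_ge0 t l u : 1 <= l -> 0 <= u -> 0 <= band_cost t l u.
Proof.
move=> l1 u0; have l0 : 0 <= l by exact: le_trans l1.
rewrite /band_cost mulr_ge0 ?exprn_ge0// mulr_ge0 ?mulr_ge0 ?sqrtr_ge0//.
by rewrite subr_ge0 exprn_ege1.
Qed.

(* Linear climbs between the levels [(u * l ^+ j) ^+ 2] with the slope of
   equipartition, [D ^+ 2 / 2 = (z - t) f] up to the factor [l], followed by a
   plateau at the first level where [z <= t + eta]. *)
Lemma ascent (t eta l : R) n (u a : R) : 0 < eta -> 1 < l -> 0 < u ->
  (z (u ^+ 2) < +oo)%E -> (z ((u * l ^+ n) ^+ 2) <= (t + eta)%:E)%E ->
  exists f D, [/\ ac_on setT f D, measurable_fun setT D, f a = u ^+ 2,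
    (forall x, a <= x -> u ^+ 2 <= f x) &
    forall x, a <= x -> (\int[mu]_(y in `[a, x]) edens f D y <=
      (t + eta)%:E * \int[mu]_(y in `[a, x]) (`|f y|)%:E +
      (\sum_(j < n) band_cost t l (u * l ^+ j))%:E)%E].
Proof.
move=> eta0 l1; have l0 : 0 < l by exact: lt_trans l1.
have plateau m (u' a' : R) : 0 < u' -> (z (u' ^+ 2) <= (t + eta)%:E)%E ->
  exists f D, [/\ ac_on setT f D, measurable_fun setT D, f a' = u' ^+ 2,
    (forall x, a' <= x -> u' ^+ 2 <= f x) &
    forall x, a' <= x -> (\int[mu]_(y in `[a', x]) edens f D y <=
      (t + eta)%:E * \int[mu]_(y in `[a', x]) (`|f y|)%:E +
      (\sum_(j < m) band_cost t l (u' * l ^+ j))%:E)%E].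
  move=> u0 zu; exists (fun x => u' ^+ 2 + 0 * (x - a')), (cst 0).
  have E x : u' ^+ 2 + 0 * (x - a') = u' ^+ 2 by rewrite mul0r addr0.
  split => //; [exact: ac_on_affine|by move=> x _; rewrite E|].
  move=> x ax.
  have te0 : 0 <= t + eta.
    by rewrite -lee_fin; apply: le_trans zu; apply: z_ge0; exact: sqr_ge0.
  have mf : measurable_fun setT (fun x : R => u' ^+ 2 + 0 * (x - a')).
    rewrite (_ : (fun _ => _) = cst (u' ^+ 2)); first exact: measurable_cst.
    by apply/funext => y; rewrite E.
  apply: (@le_trans _ _ ((t + eta)%:E * \int[mu]_(y in `[a', x])
    (`|u' ^+ 2 + 0 * (y - a')|)%:E)%E); last first.
    rewrite leeDl// lee_fin sumr_ge0// => j _; apply: band_cost_ge0; first exact: ltW.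
    by rewrite mulr_ge0 ?exprn_ge0// ltW.
  rewrite -ge0_integralZl_EFin//; last first.
    apply/measurable_EFinP; apply: measurableT_comp => //.
    exact: measurable_funS mf.
  apply: ge0_le_integral => //.
  - by move=> y _; exact: edens_ge0.
  - apply: measurable_funS (measurable_edens mf _) => //.
  - apply: measurable_funeM; apply/measurable_EFinP; apply: measurableT_comp => //.
    exact: measurable_funS mf.
  - move=> y _; rewrite /edens expr0n/= mulr0 add0e c_ofE E lee_wpmul2r ?lee_fin//.
    by rewrite ger0_norm// sqr_ge0.
elim: n u a => [|n IH] u a u0 zuoo zun.
  by apply: plateau => //; move: zun; rewrite expr0 mulr1.
have [zu|zu] := leP (z (u ^+ 2)) (t + eta)%:E; first exact: plateau.
have zufin : z (u ^+ 2) \is a fin_num by rewrite ge0_fin_numE// z_ge0// sqr_ge0.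
set K := fine (z (u ^+ 2)).
have KE : z (u ^+ 2) = K%:E by rewrite fineK.
have Kt : t + eta < K by rewrite -lte_fin -KE.
have Kt0 : 0 < K - t by lra.
(* In the band [(z(f) - t) f <= (K - t) (l u)^2 = p^2 / 2], so the density minus [t f] is at most
   [p^2]. The climb lasts [(h' - h) / p], hence costs at most [p (h' - h)]. *)
pose p : R := Num.sqrt 2 * Num.sqrt (K - t) * (l * u).
have p0 : 0 < p by rewrite !mulr_gt0// sqrtr_gt0.
have p2 : p ^+ 2 = 2 * (K - t) * (l * u) ^+ 2.
  by rewrite /p !exprMn !sqr_sqrtr// ltW.
pose h := u ^+ 2; pose h' := (l * u) ^+ 2.
have hh' : h < h'.
  by rewrite /h /h' exprMn ltr_pMl ?exprn_gt0// exprn_egt1.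
pose L := (h' - h) / p.
have L0 : 0 < L by rewrite divr_gt0// subr_gt0.
pose a' := a + L.
have aa' : a <= a' by rewrite lerDl ltW.
have lu0 : 0 < l * u by rewrite mulr_gt0.
have zlu : (z ((l * u) ^+ 2) < +oo)%E.
  by apply: le_lt_trans zuoo; apply: z_noninc; [exact: sqr_ge0|exact: ltW].
have [|f2 [D2 [ac2 mD2 f2a f2ge f2e]]] := IH (l * u) a' lu0 zlu.
  by rewrite (_ : l * u * l ^+ n = u * l ^+ n.+1)// exprS mulrA (mulrC u).
have f1a' : h + p * (a' - a) = f2 a'.
  by rewrite f2a /a' addrAC subrr add0r /L mulrC divfK ?gt_eqF// addrC subrK.
have acg := @ac_on_glue R (fun x => h + p * (x - a)) (cst p) f2 D2 a' f1a'
  (ac_on_sub (@subsetT _ _) (ac_on_affine h p a))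
  (ac_on_sub (@subsetT _ _) ac2).
set f := fun x => if x <= a' then _ else _ in acg.
set D := fun x => if x <= a' then _ else _ in acg.
have mf2 : measurable_fun setT f2 by apply: continuous_measurable_fun; exact: ac_continuous ac2.
have mD : measurable_fun setT D by exact: measurable_glue.
have mf : measurable_fun setT f by apply: continuous_measurable_fun; exact: ac_continuous acg.
have te0 : 0 <= t + eta.
  by rewrite -lee_fin; apply: le_trans zun; apply: z_ge0; exact: sqr_ge0.
have mabs : measurable_fun setT (fun y => (`|f y|)%:E).
  by apply/measurable_EFinP; exact: measurableT_comp.
have me := measurable_edens mf mD.
have cost0 : band_cost t l (u * l ^+ 0) = p * (h' - h).
  by rewrite /band_cost expr0 mulr1 -/K /p /h /h'; ring.
have low x : a <= x -> x <= a' -> (\int[mu]_(y in `[a, x]) edens f D y <=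
    (t + eta)%:E * \int[mu]_(y in `[a, x]) (`|f y|)%:E + (p * (h' - h))%:E)%E.
  move=> ax xa'.
  apply: (@le_trans _ _ (\int[mu]_(y in `[a, x]) ((t + eta)%:E * (`|f y|)%:E + (p ^+ 2)%:E))%E).
    apply: ge0_le_integral => //.
    - by move=> y _; exact: edens_ge0.
    - exact: measurable_funS me.
    - apply: emeasurable_funD => //; apply: measurable_funeM; exact: measurable_funS mabs.
    - move=> y /=; rewrite in_itv/= => /andP[ay yx].
      have ya' : y <= a' by exact: le_trans yx xa'.
      have fy : f y = h + p * (y - a) by rewrite /f ya'.
      have hfy : h <= f y by rewrite fy lerDl mulr_ge0 ?subr_ge0// ltW.
      have fyh : f y <= h'.
        rewrite fy -lerBrDl mulrC -ler_pdivlMr//; move: ya'; rewrite /a' /L; lra.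
      have fy0 : 0 <= f y by apply: le_trans hfy; exact: sqr_ge0.
      rewrite /edens c_ofE ger0_norm// /D ya'.
      apply: (@le_trans _ _ ((2^-1 * p ^+ 2)%:E + K%:E * (f y)%:E)%E).
        rewrite leeD2l// lee_wpmul2r ?lee_fin// -KE.
        by apply: z_noninc => //; exact: sqr_ge0.
      rewrite -!EFinM -!EFinD lee_fin p2 -/h'.
      have := ler_wpM2l (ltW Kt0) fyh; have := mulr_ge0 (ltW eta0) fy0; nra.
  rewrite ge0_integralD//; last 3 first.
  - by move=> y _; rewrite mule_ge0 ?lee_fin.
  - by apply: measurable_funeM; exact: measurable_funS mabs.
  - by move=> y _; rewrite lee_fin sqr_ge0.
  rewrite ge0_integralZl_EFin//; last exact: measurable_funS mabs.
  rewrite leeD2l// integral_cst//= lebesgue_measure_itv/= lte_fin.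
  have [ax'|] := ltP a x; last by rewrite mule0 lee_fin mulr_ge0 ?subr_ge0// ltW.
  rewrite -EFinB -EFinM lee_fin expr2 -mulrA ler_pM2l//.
  rewrite mulrC -ler_pdivlMr//; move: xa'; rewrite /a' /L; lra.
exists f, D; split => //.
- by rewrite /f aa' subrr mulr0 addr0.
- move=> x ax; rewrite /f; case: ifPn => [xa'|].
    by rewrite lerDl mulr_ge0 ?subr_ge0// ltW.
  by rewrite -ltNge => /ltW /f2ge; apply: le_trans; exact: ltW.
move=> x ax; rewrite big_ord_recl cost0.
have S0 : 0 <= \sum_(i < n) band_cost t l (u * l ^+ lift ord0 i).
  apply: sumr_ge0 => j _; apply: band_cost_ge0; first exact: ltW.
  by rewrite mulr_ge0 ?exprn_ge0// ltW.
have [xa'|/ltW a'x] := leP x a'.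
  by apply: le_trans (low x ax xa') _; rewrite leeD2l// lee_fin lerDl.
rewrite (ge0_integral_itv_split aa' a'x)//; last exact: edens_ge0.
rewrite (ge0_integral_itv_split aa' a'x mabs)//.
have E2 (k1 k2 : R -> \bar R) : measurable_fun setT k1 -> measurable_fun setT k2 ->
    (forall y, a' < y -> k1 y = k2 y) ->
    (\int[mu]_(y in `[a', x]) k1 y = \int[mu]_(y in `[a', x]) k2 y)%E.
  move=> m1 m2 k12; rewrite -[LHS]integral_itv_obnd_cbnd; last exact: measurable_funS m1.
  rewrite -[RHS]integral_itv_obnd_cbnd; last exact: measurable_funS m2.
  by apply: eq_integral => y; rewrite inE/= in_itv/= => /andP[/k12].
have off (y : R) : a' < y -> f y = f2 y /\ D y = D2 y.
  by move=> ay; rewrite /f /D leNgt ay.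
rewrite (E2 _ (edens f2 D2))//; last 2 first.
- exact: measurable_edens.
- by move=> y /off[fy Dy]; rewrite /edens fy Dy.
rewrite [X in (_ * (_ + X))%E](E2 _ (fun y => (`|f2 y|)%:E))//; last 2 first.
- by apply/measurable_EFinP; exact: measurableT_comp.
- by move=> y /off[fy _]; rewrite fy.
rewrite ge0_muleDr ?integral_ge0// [X in (_ <= _ + X)%E]EFinD [leRHS]addeACA.
apply: leeD.
  exact: (low a' aa' (lexx a')).
have -> : \sum_(i < n) band_cost t l (u * l ^+ lift ord0 i) =
    \sum_(j < n) band_cost t l (l * u * l ^+ j).
  by apply: eq_bigr => j _; rewrite lift0 exprS mulrA (mulrC u).
exact: f2e.
Qed.

(** Dominated convergence: the half-lines shrink to a set on which [G] vanishes. This covers both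
    [a n] tending to minus infinity and [a n] decreasing to a zero of the profile. *)
Lemma integral_tail_small (G : R -> \bar R) (p : R) (a : nat -> R) (d : R) :
  measurable_fun setT G -> (forall x, 0 <= G x)%E ->
  (\int[mu]_(x in `]-oo, p]) G x < +oo)%E ->
  (forall n, a n <= p) -> {homo a : i j / (i <= j)%N >-> j <= i} ->
  (forall x, (forall n, x <= a n) -> G x = 0) -> 0 < d ->
  exists n, (\int[mu]_(x in `]-oo, a n]) G x <= d%:E)%E.
Proof.
move=> mG G0 Goo ap ani Ga d0.
have : (\int[mu]_x (G \_ `]-oo, a n]) x)%E @[n --> \oo] --> 0%E.
  have [|||||_ _ c] := @dominated_convergence _ _ _ mu setT measurableT
    (fun n => G \_ `]-oo, a n]) (cst 0%E) (G \_ `]-oo, p]).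
  - move=> n; apply/(measurable_restrictT _ _).1 => //; exact: measurable_funS mG.
  - exact: measurable_cst.
  - apply: aeW => x _; have [xa|] := pselect (forall n, x <= a n).
      apply: cvg_near_cst; apply: nearW => n; rewrite patchE; case: ifP => // _.
      exact: Ga.
    move=> /existsNP[N /negP]; rewrite -ltNge => aN.
    apply: cvg_near_cst; exists N => // n /= Nn; rewrite patchE ifF//; apply/negbTE/negP.
    by rewrite inE/= in_itv/= leNgt (le_lt_trans (ani _ _ Nn) aN).
  - apply/(@integrable_mkcond _ _ _ mu `]-oo, p] G) => //.
    apply/integrableP; split; first exact: measurable_funS mG.
    by under eq_integral do rewrite gee0_abs//.
  - apply: aeW => x n _; rewrite !patchE; case: ifPn => [|_]; last first.
      by rewrite abse0; case: ifP => // _; exact: G0.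
    rewrite inE/= in_itv/= => xa; rewrite ifT ?gee0_abs//.
    by rewrite inE/= in_itv/= (le_trans xa).
  by move: c; rewrite integral_cst// mul0e.
move=> cvg0; apply: contrapT => /forallNP H.
have : (d%:E <= limn (fun n => \int[mu]_x (G \_ `]-oo, a n]) x))%E.
  apply: lime_ge; first by apply/cvg_ex; exists 0%E.
  apply: nearW => n; rewrite -integral_mkcond ltW// ltNge; apply/negP; exact: H.
by rewrite (cvg_lim _ cvg0)// lee_fin leNgt d0.
Qed.

(* Following [f] leftwards from a point where it is positive, either it never
   vanishes or it is cut off at its last zero. *)
Lemma energy_tail (f D : R -> R) (w d : R) : ac_on setT f D ->
  measurable_fun setT D -> (forall x, 0 <= f x) -> 0 < w ->
  (\int[mu]_x (f x)%:E = w%:E)%E -> (\int[mu]_x edens f D x < +oo)%E -> 0 < d ->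
  exists a g D', [/\ ac_on setT g D', measurable_fun setT D', (forall x, 0 <= g x),
    0 < g a & (\int[mu]_(x in `]-oo, a]) (g x)%:E <= d%:E)%E /\
      (\int[mu]_(x in `]-oo, a]) edens g D' x <= d%:E)%E].
Proof.
move=> acf mD f0 w0 fw Eoo d0.
have cf := ac_continuous acf.
have [p fp] : exists p, 0 < f p.
  apply: contrapT => H.
  have : (\int[mu]_x (f x)%:E = 0)%E.
    apply: integral0_eq => x _; congr EFin; apply/eqP; rewrite eq_le f0 andbT leNgt.
    by apply/negP => fx; apply: H; exists x.
  by rewrite fw => -[] w00; rewrite w00 ltxx in w0.
(* Common end of both cases: [g] is [f], possibly cut off to 0, it is positive along [a], and it
   vanishes below all the [a n]. Mass and energy are added into one function, so one index serves
   both. *)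
have finish g D' (a : nat -> R) : ac_on setT g D' -> measurable_fun setT D' ->
    (forall x, 0 <= g x) -> (forall n, 0 < g (a n)) -> (forall n, a n <= p) ->
    {homo a : i j / (i <= j)%N >-> j <= i} ->
    (forall x, (g x = f x /\ D' x = D x) \/ (g x = 0 /\ D' x = 0)) ->
    (forall x, (forall n, x <= a n) -> g x = 0 /\ D' x = 0) ->
    exists a g D', [/\ ac_on setT g D', measurable_fun setT D', (forall x, 0 <= g x),
    0 < g a & (\int[mu]_(x in `]-oo, a]) (g x)%:E <= d%:E)%E /\
      (\int[mu]_(x in `]-oo, a]) edens g D' x <= d%:E)%E].
  move=> acg mD' g0 ga ap ani gf gz.
  have mg : measurable_fun setT g by apply: continuous_measurable_fun; exact: ac_continuous acg.
  have mf : measurable_fun setT f by apply: continuous_measurable_fun.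
  have mgE : measurable_fun setT (fun x => (g x)%:E) by exact/measurable_EFinP.
  have mfE : measurable_fun setT (fun x => (f x)%:E) by exact/measurable_EFinP.
  have me := measurable_edens mg mD'.
  have g0E x : (0 <= (g x)%:E)%E by rewrite lee_fin.
  have f0E x : (0 <= (f x)%:E)%E by rewrite lee_fin.
  pose G x := ((g x)%:E + edens g D' x)%E.
  have G0 x : (0 <= G x)%E by rewrite adde_ge0 ?edens_ge0.
  have mG : measurable_fun setT G by exact: emeasurable_funD.
  have e00 x : g x = 0 -> D' x = 0 -> edens g D' x = 0%E.
    by move=> gx Dx; rewrite /edens gx Dx normr0 c_ofE mule0 expr0n/= mulr0 adde0.
  have [|x /gz[gx Dx]|n Hn] := @integral_tail_small G p a d mG G0 _ ap ani _ d0.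
  - apply: (@le_lt_trans _ _ (\int[mu]_x ((f x)%:E + edens f D x))%E); last first.
      rewrite ge0_integralD//; [|by move=> *; exact: edens_ge0|exact: measurable_edens].
      by rewrite fw lte_add_pinfty// ltry.
    apply: (@le_trans _ _ (\int[mu]_x G x)%E); first exact: ge0_subset_integral.
    apply: ge0_le_integral => //.
      by apply: emeasurable_funD => //; exact: measurable_edens.
    move=> x _; have [[gx Dx]|[gx Dx]] := gf x; rewrite /G.
      by rewrite gx /edens gx Dx.
    by rewrite e00// gx adde0 adde_ge0 ?edens_ge0.
  - by rewrite /G e00// gx adde0.
  exists (a n), g, D'; split => //; split; apply: le_trans Hn.
    apply: ge0_le_integral => //; [exact: measurable_funS mgE|exact: measurable_funS mG|].
    by move=> x _; rewrite leeDl ?edens_ge0.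
  apply: ge0_le_integral => //;
    [by move=> *; exact: edens_ge0|exact: measurable_funS me|exact: measurable_funS mG|].
  by move=> x _; rewrite leeDr.
have [[y yp fy]|nz] := pselect (exists2 y, y <= p & f y = 0).
  have cNf : continuous (fun x => - f x) by move=> x; apply: cvgN; exact: cf.
  have [|b /andP[yb bp] [fb Hb]] := @last_ge _ _ _ _ 0 cNf yp; first by rewrite fy oppr0.
  have {}fb : f b = 0 by apply/eqP; rewrite eq_le f0 andbT -oppr_ge0.
  have {}Hb x : b < x -> x <= p -> 0 < f x by move=> bx xp; rewrite -oppr_lt0; exact: Hb.
  have bp' : b < p by rewrite lt_neqAle bp andbT; apply/eqP => bp'; rewrite -bp' fb ltxx in fp.
  (* These points decrease from [p] to the last zero [b] without reaching it, so [f] stays positive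
     on them. *)
  pose a (n : nat) := b + (p - b) / n.+1%:R.
  have ba n : b < a n by rewrite /a ltrDl divr_gt0// subr_gt0.
  have ap n : a n <= p.
    rewrite /a -lerBrDl ler_pdivrMr// ler_peMr ?subr_ge0 ?(ltW bp')//.
    by rewrite ler1n.
  have ac0 : ac_on [set x | x <= b] (cst 0) (cst (0 : R)).
    have := ac_on_affine 0 0 0; rewrite (_ : (fun x => _) = cst (0 : R)); last first.
      by apply/funext => x; rewrite mul0r addr0.
    exact: ac_on_sub.
  have := @ac_on_glue R (cst 0) (cst 0) f D b (esym fb) ac0 (ac_on_sub (@subsetT _ _) acf).
  move=> acg; apply: (finish _ _ a acg).
  - exact: measurable_glue.
  - by move=> x; case: ifP.
  - by move=> n; rewrite ifF ?Hb//; apply/negbTE; rewrite -ltNge.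
  - exact: ap.
  - apply/nonincreasing_seqP => n; rewrite /a lerD2l ler_pM2l ?subr_gt0//.
    by rewrite lef_pV2 ?posrE// ler_nat.
  - by move=> x; case: ifP => _; [right|left].
  - move=> x xa; suff xb : x <= b by rewrite xb.
    have ca : a n @[n --> \oo] --> b.
      rewrite -[X in _ --> X]addr0; apply: cvgD; first exact: cvg_cst.
      rewrite -[X in _ --> X](mulr0 (p - b)); apply: cvgMr; exact: cvg_harmonic.
    rewrite -(cvg_lim _ ca)//; apply: limr_ge; first by apply/cvg_ex; exists b.
    exact: nearW.
have fpos x : x <= p -> 0 < f x.
  by move=> xp; rewrite lt_neqAle f0 andbT; apply/eqP => fx; apply: nz; exists x.
apply: (finish f D (fun n => p - n%:R)) => //.
- by move=> n; apply: fpos; rewrite gerBl.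
- by move=> n; rewrite gerBl.
- by move=> i j ij; rewrite lerD2l lerN2 ler_nat.
- by move=> x; left.
- move=> x xa; exfalso.
  have := xa (Num.bound (p - x)); have := @archi_boundP _ (p - x).
  have px : 0 <= p - x by have := xa 0%N; rewrite subr0 subr_ge0.
  by move=> /(_ px) h1 h2; lra.
Qed.

Lemma integral_symmetrize (k : R -> \bar R) (x : R) : measurable_fun setT k ->
  (forall y, 0 <= k y)%E ->
  (\int[mu]_y (if (y <= x)%R then k y else k (2 * x - y)%R) =
   \int[mu]_(y in `]-oo, x]) k y + \int[mu]_(y in `]-oo, x]) k y)%E.
Proof.
move=> mk k0.
have mr : measurable_fun setT (fun y : R => k (2 * x - y)%R).
  exact: (measurableT_comp mk (measurable_reflection (2 * x))).
rewrite (ge0_integral_splitT x); last 2 first.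
- by apply: measurable_fun_ifT => //; exact: measurable_fun_ler.
- by move=> y; case: ifP.
congr (_ + _)%E.
  by apply: eq_integral => y; rewrite inE/= in_itv/= => ->.
transitivity (\int[mu]_(y in `[x, +oo[) k (2 * x - y)%R)%E.
  rewrite -[LHS]integral_itv_obnd_cbnd; last first.
    apply: (@measurable_funS _ _ _ _ setT) => //.
    by apply: measurable_fun_ifT => //; exact: measurable_fun_ler.
  rewrite -[RHS]integral_itv_obnd_cbnd; last exact: measurable_funS mr.
  apply: eq_integral => y; rewrite inE/= in_itv/= andbT => xy.
  by rewrite ifF//; apply/negbTE; rewrite -ltNge.
rewrite (ge0_integral_reflect (2 * x) (measurable_itv _) mr) => [|y]; last exact: k0.
rewrite preimage_reflect_itvcy (_ : 2 * x - x = x); last by ring.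
by apply: eq_integral => y _; rewrite subKr.
Qed.

Lemma tau_z_le (f D : R -> R) (w : R) : ac_on setT f D -> measurable_fun setT D ->
  (forall x, 0 <= f x) -> (\int[mu]_x (f x)%:E = w%:E)%E ->
  (tau_z z w <= \int[mu]_x edens f D x)%E.
Proof.
move=> acf mD f0 fw; apply: (@le_trans _ _ (energy (c_of z) f)).
  by apply: ereal_inf_lbound; exists f.
by apply: ereal_inf_lbound; exists D => //; exact: ac_weak_deriv.
Qed.

Lemma convol_ge0 t : (0 <= convol (g_of z) (@r_ker R) t)%E.
Proof.
by apply: integral_ge0 => s _; rewrite mule_ge0 ?g_of_ge0// lee_fin r_ker_ge0.
Qed.

Lemma step_le_convol (t K v : R) : 0 <= v -> (K%:E <= z (v ^+ 2))%E ->
  ((v ^+ 3 * (4 / 3 * Num.sqrt 2 * Num.sqrt (K - t)))%:E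
    <= convol (g_of z) (@r_ker R) t)%E.
Proof.
move=> v0 Kz.
have := @steps_le_convol _ z z_noninc (fun j => if j is 0%N then 0 else v) (fun=> K) 1 t (lexx 0).
rewrite big_ord_recl big_ord0 addr0/= expr0n/= subr0; apply.
  by case=> [|i] [|j].
by [].
Qed.

(** An infinite value at [h] keeps [g >= h^(3/2)] at all [s], and the kernel has infinite total
    integral. A single step of height [t + A ^+ 2] already yields [fine G + 1]. *)
Lemma convol_fin_z_fin t h : (convol (g_of z) (@r_ker R) t < +oo)%E -> 0 < h ->
  (z h < +oo)%E.
Proof.
move=> Goo h0; rewrite ltNge leye_eq; apply/negP => /eqP zh.
set G := convol _ _ _ in Goo.
have Gfin : G \is a fin_num by rewrite ge0_fin_numE// convol_ge0.
pose v := Num.sqrt h.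
have v0 : 0 < v by rewrite sqrtr_gt0.
pose c := v ^+ 3 * (4 / 3 * Num.sqrt 2).
have c0 : 0 < c by rewrite mulr_gt0 ?exprn_gt0// mulr_gt0 ?sqrtr_gt0.
pose A := (fine G + 1) / c.
have A0 : 0 <= A by rewrite divr_ge0 ?addr_ge0 ?fine_ge0 ?convol_ge0// ltW.
have := @step_le_convol t (t + A ^+ 2) v (ltW v0).
have -> : v ^+ 2 = h by rewrite sqr_sqrtr// ltW.
rewrite zh leey => /(_ isT).
rewrite addrAC subrr add0r sqrtr_sqr ger0_norm// mulrA -/c /A mulrC divfK ?gt_eqF//.
by rewrite -/G -[X in (_ <= X)%E]fineK// lee_fin; lra.
Qed.

(** Otherwise [g] would be infinite on [s < t + eta], where the kernel has positive mass. The level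
    found is where the ascent may stop. *)
Lemma convol_fin_z_low t eta : (convol (g_of z) (@r_ker R) t < +oo)%E -> 0 < eta ->
  exists2 T, 0 < T & (z T <= (t + eta)%:E)%E.
Proof.
move=> Goo e0; apply: contrapT => H.
have zlow T : 0 < T -> ((t + eta)%:E <= z T)%E.
  by move=> T0; rewrite leNgt; apply/negP => zT; apply: H; exists T => //; exact: ltW.
set G := convol _ _ _ in Goo.
have Gfin : G \is a fin_num by rewrite ge0_fin_numE// convol_ge0.
pose c := 4 / 3 * Num.sqrt 2 * Num.sqrt eta.
have c0 : 0 < c by rewrite !mulr_gt0 ?sqrtr_gt0.
have G0 : 0 <= fine G by rewrite fine_ge0// convol_ge0.
pose v := 1 + (fine G + 1) / c.
have v1 : 1 <= v by rewrite lerDl divr_ge0 ?addr_ge0// ltW.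
have v0 : 0 < v by exact: lt_le_trans v1.
have := @step_le_convol t (t + eta) v (ltW v0) (zlow _ (exprn_gt0 2 v0)).
rewrite addrAC subrr add0r -/c -/G -[X in (_ <= X)%E]fineK// lee_fin.
have v3 : v <= v ^+ 3 by rewrite ler_eXnr.
have := ler_wpM2r (ltW c0) v3; rewrite {1}/v mulrDl divfK ?gt_eqF// mul1r; lra.
Qed.

(** The climb reads [z] at the bottom of each band, but a lower sum for the convolution must read it
    at the top of a step; the steps are therefore shifted down by one factor [l]. The comparison
    reduces to [2 * l ^+ 3 - 3 * l ^+ 2 + 1 = (l - 1) ^+ 2 * (2 * l + 1)]. *)
Lemma band_costs_le (t l u : R) n : 1 < l -> 0 < u ->
  (convol (g_of z) (@r_ker R) t < +oo)%E ->
  2 * \sum_(j < n) band_cost t l (u * l ^+ j) <=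
    l ^+ 4 * fine (convol (g_of z) (@r_ker R) t).
Proof.
move=> l1 u0 Goo; have l0 : 0 < l by exact: lt_trans l1.
set G := convol _ _ _ in Goo *.
have Gfin : G \is a fin_num by rewrite ge0_fin_numE// convol_ge0.
pose v (j : nat) := u / l * l ^+ j.
have v0 j : 0 < v j by rewrite mulr_gt0 ?exprn_gt0// divr_gt0.
have vS j : v j.+1 = u * l ^+ j by rewrite /v exprS mulrA divfK// gt_eqF.
have vl j : v j.+1 = l * v j by rewrite /v exprS mulrCA.
have zf j : z (v j.+1 ^+ 2) \is a fin_num.
  rewrite ge0_fin_numE ?z_ge0 ?sqr_ge0//.
  by apply: (convol_fin_z_fin Goo); rewrite exprn_gt0.
have := @steps_le_convol _ z z_noninc v (fun j => fine (z (v j.+1 ^+ 2))) n t (ltW (v0 0%N)).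
have vnd : {homo v : i j / (i <= j)%N >-> i <= j}.
  by apply/nondecreasing_seqP => j; rewrite vl ler_peMl// ltW.
have Kz j : (j < n)%N -> ((fine (z (v j.+1 ^+ 2)))%:E <= z (v j.+1 ^+ 2))%E.
  by rewrite fineK.
move=> /(_ vnd Kz); rewrite -/G -[X in (_ <= X)%E]fineK// lee_fin => H.
apply: le_trans (ler_wpM2l (exprn_ge0 4 (ltW l0)) H).
rewrite !mulr_sumr; apply: ler_sum => j _.
rewrite /band_cost -vS.
set c := Num.sqrt (_ - _).
have c0 : 0 <= c by rewrite sqrtr_ge0.
rewrite !vl; set y := v j.
have y0 : 0 < y by exact: v0.
rewrite -subr_ge0.
have -> : l ^+ 4 * (((l * y) ^+ 3 - y ^+ 3) * (4 / 3 * Num.sqrt 2 * c)) -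
  2 * (Num.sqrt 2 * c * (l * (l ^+ 2 - 1)) * (l * y) ^+ 3) =
  2 / 3 * (l ^+ 4 * (Num.sqrt 2 * c * y ^+ 3)) * ((l - 1) ^+ 2 * (2 * l + 1)) by field.
apply: mulr_ge0; last by apply: mulr_ge0; [exact: sqr_ge0|rewrite addr_ge0// mulr_ge0// ltW].
apply: mulr_ge0; first by rewrite divr_ge0.
apply: mulr_ge0; first by rewrite exprn_ge0// ltW.
by rewrite mulr_ge0 ?exprn_ge0 ?(ltW y0)// mulr_ge0 ?sqrtr_ge0.
Qed.

(** Mass and energy ignore null sets. Nonnegativity passes to the continuous representative, as a
    negative value would persist on a ball of positive measure. *)
Lemma ac_representative (psi dpsi : R -> R) (w : R) : weak_deriv psi dpsi ->
  (forall y, 0 <= psi y) -> (\int[mu]_x (psi x)%:E = w%:E)%E ->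
  exists f, [/\ ac_on setT f dpsi, (forall x, 0 <= f x), (\int[mu]_x (f x)%:E = w%:E)%E &
    (\int[mu]_x edens f dpsi x = \int[mu]_x edens psi dpsi x)%E].
Proof.
move=> wd psi0 psiw; have [[mpsi _ _] [[mdpsi _ _] _]] := wd.
have [f [acf cf aef]] := weak_deriv_ac wd.
have mf : measurable_fun setT f by exact: continuous_measurable_fun.
have f0 x : 0 <= f x.
  rewrite leNgt; apply/negP => fx.
  have /cvgr_lt/(_ _ fx)[/= e e0 He] := cf x.
  have [A [mA A0 sA]] := aef.
  have BA : ball x e `<=` A.
    move=> y xy; apply: sA => /= pf; have := He y xy.
    by rewrite -pf ltNge psi0.
  have : (mu (ball x e) <= mu A)%E by apply: le_measure => //; rewrite inE//; exact: measurable_ball.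
  rewrite A0 lebesgue_measure_ball; last exact: ltW.
  by rewrite lee_fin mulr2n leNgt addr_gt0.
exists f; split => //.
  rewrite -psiw; apply: ge0_ae_eq_integral => //.
  - exact/measurable_EFinP.
  - exact/measurable_EFinP.
  - by move=> x _; rewrite lee_fin.
  - by move=> x _; rewrite lee_fin.
  - by apply: (@filterS _ _ (ae_filter_ringOfSetsType mu) _ _ _ aef) => x -> _.
apply: ge0_ae_eq_integral => //.
- exact: measurable_edens.
- exact: measurable_edens.
- by move=> x _; exact: edens_ge0.
- by move=> x _; exact: edens_ge0.
- by apply: (@filterS _ _ (ae_filter_ringOfSetsType mu) _ _ _ aef) => x E _; rewrite /edens E.
Qed.

Lemma tau_z_lt (w : R) (e : \bar R) : (tau_z z w < e)%E -> exists f D,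
  [/\ ac_on setT f D, measurable_fun setT D, (forall x, 0 <= f x),
      (\int[mu]_x (f x)%:E = w%:E)%E & (\int[mu]_x edens f D x < e)%E].
Proof.
move=> /ereal_inf_lt[_ [psi [psi0 psiw] <-]] /ereal_inf_lt[_ [dpsi wd <-]] lt_e.
have [f [acf f0 fw fE]] := ac_representative wd psi0 psiw.
exists f, dpsi; split => //; last by rewrite fE.
by case: wd => _ [[]].
Qed.

Lemma tau_z0 : (tau_z z 0 <= 0)%E.
Proof.
have ac0 : ac_on setT (cst 0) (cst (0 : R)).
  have := ac_on_affine 0 0 0; rewrite (_ : (fun x => _) = cst (0 : R))//.
  by apply/funext => x; rewrite mul0r addr0.
apply: le_trans (tau_z_le ac0 _ _ _) _ => //; first by rewrite integral0_eq.
rewrite integral0_eq// => x _.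
by rewrite /edens normr0 c_ofE mule0 expr0n/= mulr0 adde0.
Qed.

(* Tail of [f], then [ascent] until the mass is [w / 2], then reflection. *)
Lemma tau_z_competitor (t eta l d w : R) (f D : R -> R) (w1 : R) :
  ac_on setT f D -> measurable_fun setT D -> (forall x, 0 <= f x) -> 0 < w1 ->
  (\int[mu]_x (f x)%:E = w1%:E)%E -> (\int[mu]_x edens f D x < +oo)%E ->
  0 < eta -> 1 < l -> 0 < d -> d < w / 2 ->
  (convol (g_of z) (@r_ker R) t < +oo)%E ->
  (tau_z z w <= (2 * d + (t + eta) * w + l ^+ 4 * fine (convol (g_of z) (@r_ker R) t))%:E)%E.
Proof.
move=> acf mD f0 w10 fw1 Eoo eta0 l1 d0 dw Goo.
have l0 : 0 < l by exact: lt_trans l1.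
have [T T0 zT] := convol_fin_z_low Goo eta0.
have te0 : 0 <= t + eta by rewrite -lee_fin; apply: le_trans zT; apply: z_ge0; exact: ltW.
have [a [f1 [D1 [ac1 mD1 f10 f1a [f1m f1e]]]]] := energy_tail acf mD f0 w10 fw1 Eoo d0.
pose u := Num.sqrt (f1 a).
have u0 : 0 < u by rewrite sqrtr_gt0.
have u2 : u ^+ 2 = f1 a by rewrite sqr_sqrtr// ltW.
have [n Tn] : exists n, T <= (u * l ^+ n) ^+ 2.
  have bern m : 1 + m%:R * (l - 1) <= l ^+ m.
    elim: m => [|m IH]; first by rewrite mul0r addr0 expr0.
    rewrite exprS -natr1; have := ler_wpM2l (ltW l0) IH.
    have : 0 <= m%:R * (l - 1) * (l - 1).
      by rewrite !mulr_ge0// subr_ge0 ltW.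
    lra.
  pose r := Num.sqrt T / u / (l - 1).
  have r0 : 0 <= r.
    by rewrite !divr_ge0 ?sqrtr_ge0 ?subr_ge0 ?(ltW u0) ?(ltW l1).
  exists (Num.bound r); have hr := archi_boundP r0.
  rewrite -[leLHS](sqr_sqrtr (ltW T0)) lerXn2r ?nnegrE ?sqrtr_ge0//.
    by rewrite mulr_ge0 ?exprn_ge0// ltW.
  rewrite mulrC -ler_pdivrMr//; apply: le_trans (bern _).
  move/ltW: hr; rewrite {1}/r ler_pdivrMr ?subr_gt0// => hr.
  by apply: le_trans hr _; rewrite lerDr.
have zu : (z (u ^+ 2) < +oo)%E by apply: (convol_fin_z_fin Goo); rewrite exprn_gt0.
have zun : (z ((u * l ^+ n) ^+ 2) <= (t + eta)%:E)%E.
  by apply: le_trans zT; apply: z_noninc => //; exact: ltW.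
have [f2 [D2 [ac2 mD2 f2a f2ge f2e]]] := ascent a eta0 l1 u0 zu zun.
set S := \sum_(j < n) _ in f2e.
have SG : 2 * S <= l ^+ 4 * fine (convol (g_of z) (@r_ker R) t) by exact: band_costs_le.
have f12 : f1 a = f2 a by rewrite f2a.
have acg := @ac_on_glue R f1 D1 f2 D2 a f12 (ac_on_sub (@subsetT _ _) ac1)
  (ac_on_sub (@subsetT _ _) ac2).
set g := fun x => if x <= a then _ else _ in acg.
set Dg := fun x => if x <= a then _ else _ in acg.
have mDg : measurable_fun setT Dg by exact: measurable_glue.
have cg := ac_continuous acg.
have mg : measurable_fun setT g by exact: continuous_measurable_fun.
have mgE : measurable_fun setT (fun x => (g x)%:E) by exact/measurable_EFinP.
have mf2 : measurable_fun setT f2 by apply: continuous_measurable_fun; exact: ac_continuous ac2.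
have g0 x : 0 <= g x.
  rewrite /g; case: (leP x a) => // /ltW /f2ge; apply: le_trans; exact: sqr_ge0.
have g0E x : (0 <= (g x)%:E)%E by rewrite lee_fin.
have gge x : a <= x -> u ^+ 2 <= g x.
  move=> ax; rewrite /g; case: ifPn => [xa|_]; last exact: f2ge.
  by rewrite u2 (_ : x = a)//; apply/eqP; rewrite eq_le xa ax.
have me := measurable_edens mg mDg.
have tailE (k k1 : R -> \bar R) : (forall y, y <= a -> k y = k1 y) ->
    (\int[mu]_(y in `]-oo, a]) k y = \int[mu]_(y in `]-oo, a]) k1 y)%E.
  by move=> kk; apply: eq_integral => y; rewrite inE/= in_itv/= => /kk.
have bodyE x (k k2 : R -> \bar R) : measurable_fun setT k -> measurable_fun setT k2 ->
    (forall y, a < y -> k y = k2 y) ->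
    (\int[mu]_(y in `[a, x]) k y = \int[mu]_(y in `[a, x]) k2 y)%E.
  move=> mk mk2 kk; rewrite -[LHS]integral_itv_obnd_cbnd; last exact: measurable_funS mk.
  rewrite -[RHS]integral_itv_obnd_cbnd; last exact: measurable_funS mk2.
  by apply: eq_integral => y; rewrite inE/= in_itv/= => /andP[/kk].
have gtail : (\int[mu]_(y in `]-oo, a]) (g y)%:E <= d%:E)%E.
  by rewrite (tailE _ (fun y => (f1 y)%:E))// => y ya; rewrite /g ya.
have etail : (\int[mu]_(y in `]-oo, a]) edens g Dg y <= d%:E)%E.
  by rewrite (tailE _ (edens f1 D1))// => y ya; rewrite /edens /g /Dg ya.
have ebody x : a <= x -> (\int[mu]_(y in `[a, x]) edens g Dg y <=
    (t + eta)%:E * \int[mu]_(y in `[a, x]) (g y)%:E + S%:E)%E.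
  move=> ax; rewrite (bodyE x _ (edens f2 D2))//; last 2 first.
  - exact: measurable_edens.
  - by move=> y ay; rewrite /edens /g /Dg leNgt ay.
  rewrite (bodyE x (fun y => (g y)%:E) (fun y => (`|f2 y|)%:E))//; first exact: f2e.
    by apply/measurable_EFinP; exact: measurableT_comp.
  move=> y ay; rewrite /g leNgt ay/= ger0_norm//; apply: le_trans (f2ge y (ltW ay)).
  exact: sqr_ge0.
set m1 := (\int[mu]_(y in `]-oo, a]) (g y)%:E)%E in gtail.
have m10 : (0 <= m1)%E by exact: integral_ge0.
have m1fin : m1 \is a fin_num by rewrite ge0_fin_numE// (le_lt_trans gtail)// ltry.
have m1d : fine m1 <= d by rewrite -lee_fin fineK.
(* Right of [a] the profile is at least [u ^+ 2], so mass [w / 2] has been collected by [b]. *)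
pose b := a + (w / 2) / u ^+ 2.
have w20 : 0 < w / 2 by exact: lt_trans dw.
have ab : a <= b by rewrite lerDl divr_ge0 ?sqr_ge0// ltW.
have ig x y : mu.-integrable `[x, y] (EFin \o g).
  by apply: continuous_compact_integrable; [exact: segment_compact|exact: continuous_subspaceT].
(* The future axis of symmetry. The target is nonnegative because the tail has mass at most
   [d < w / 2]. *)
have [x] : exists2 x, x \in `[a, b] & parameterized_integral mu a x g = w / 2 - fine m1.
  apply: IVT => //; first exact: parameterized_integral_continuous.
  rewrite ge_min le_max; apply/andP; split; apply/orP; [left|right].
    rewrite /parameterized_integral set_itv1 Rintegral_set1; lra.
  apply: (@le_trans _ _ (w / 2)); first by rewrite lerBlDr lerDl fine_ge0.
  rewrite -lee_fin /parameterized_integral /Rintegral fineK; last exact: integrable_fin_num.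
  apply: (@le_trans _ _ (\int[mu]_(y in `[a, b]) (cst (u ^+ 2)%:E y))%E).
    rewrite integral_cst//= lebesgue_measure_itv/= lte_fin.
    rewrite /b ltrDl divr_gt0 ?exprn_gt0// -EFinB -EFinM lee_fin.
    by rewrite [a + _ - a]addrAC subrr add0r [leRHS]mulrC divfK// gt_eqF// exprn_gt0.
  apply: ge0_le_integral => //.
  - by move=> y _; rewrite lee_fin sqr_ge0.
  - exact: measurable_funS mgE.
  - by move=> y /=; rewrite in_itv/= => /andP[ay _]; rewrite lee_fin gge.
rewrite in_itv/= => /andP[ax _] xm.
have mass : (\int[mu]_(y in `]-oo, x]) (g y)%:E = (w / 2)%:E)%E.
  rewrite (ge0_integral_itv_splitNy ax mgE g0E) -/m1 -(fineK m1fin).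
  have -> : (\int[mu]_(y in `[a, x]) (g y)%:E = (w / 2 - fine m1)%:E)%E.
    by rewrite -xm /parameterized_integral /Rintegral fineK//; exact: integrable_fin_num.
  by rewrite -EFinD; congr EFin; ring.
have acr := ac_on_reflect (c := 2 * x) mDg acg.
rewrite preimage_setT in acr.
have gx : g x = g (2 * x - x) by congr g; ring.
have := @ac_on_glue R g Dg _ _ x gx (ac_on_sub (@subsetT _ _) acg) (ac_on_sub (@subsetT _ _) acr).
set F := fun y => if y <= x then _ else _.
set DF := fun y => if y <= x then _ else _.
move=> acF.
have mDF : measurable_fun setT DF.
  apply: measurable_glue => //; apply: measurableT_comp => //.
  exact: (measurableT_comp mDg (measurable_reflection (2 * x))).
have F0 y : 0 <= F y by rewrite /F; case: ifP.
have Fw : (\int[mu]_y (F y)%:E = w%:E)%E.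
  transitivity (\int[mu]_y (if (y <= x)%R then (g y)%:E else (g (2 * x - y)%R)%:E))%E.
    by apply: eq_integral => y _; rewrite /F; case: ifP.
  by rewrite (@integral_symmetrize (fun y => (g y)%:E))// mass -EFinD -splitr.
apply: (le_trans (tau_z_le acF mDF F0 Fw)).
have -> : (\int[mu]_y edens F DF y = \int[mu]_(y in `]-oo, x]) edens g Dg y
    + \int[mu]_(y in `]-oo, x]) edens g Dg y)%E.
  rewrite -integral_symmetrize//; last by move=> y; exact: edens_ge0.
  by apply: eq_integral => y _; rewrite /edens /F /DF; case: ifP => // _; rewrite sqrrN.
have half : (\int[mu]_(y in `]-oo, x]) edens g Dg y <= (d + ((t + eta) * (w / 2) + S))%:E)%E.
  rewrite (ge0_integral_itv_splitNy ax me); last by move=> y; exact: edens_ge0.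
  rewrite EFinD leeD//; apply: (le_trans (ebody x ax)).
  rewrite [leRHS]EFinD leeD2r// EFinM -mass lee_wpmul2l// ?lee_fin//.
  apply: ge0_subset_integral => //; first exact: measurable_funS mgE.
  by move=> y /=; rewrite !in_itv/= => /andP[].
apply: (le_trans (leeD half half)); rewrite -EFinD lee_fin.
by move: SG; lra.
Qed.

Lemma tau_z_upper (t w w1 : R) : 0 < w1 -> (tau_z z w1 < +oo)%E -> 0 <= w ->
  (tau_z z w <= convol (g_of z) (@r_ker R) t + (t * w)%:E)%E.
Proof.
move=> w10 /tau_z_lt[f [D [acf mD f0 fw1 Eoo]]].
rewrite le_eqVlt => /predU1P[<-|w0].
  by rewrite mulr0 adde0; apply: le_trans tau_z0 _; exact: convol_ge0.
have G0 := convol_ge0 t.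
have [Goo|] := ltP (convol (g_of z) (@r_ker R) t) +oo%E; last first.
  by rewrite leye_eq => /eqP ->; rewrite addye// leey.
have Gfin : convol (g_of z) (@r_ker R) t \is a fin_num by rewrite ge0_fin_numE.
apply/lee_addgt0Pr => eps eps0.
have e30 : 0 < eps / 3 by rewrite divr_gt0.
have [l l1 lG] := expr4_le_add (fine_ge0 G0) e30.
(* Each error gets a third of [eps]: the two tails [2 * d], the excess [eta * w], and the factor
   [l ^+ 4]. *)
pose d := Num.min (w / 4) (eps / 6).
have d0 : 0 < d by rewrite lt_min !divr_gt0.
have d1 : d <= w / 4 by rewrite ge_min lexx.
have d2 : d <= eps / 6 by rewrite ge_min lexx orbT.
pose eta := eps / 3 / w.
have eta0 : 0 < eta by rewrite divr_gt0.
have etaw : eta * w = eps / 3 by rewrite divfK// gt_eqF.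
have dw : d < w / 2 by lra.
apply: le_trans (tau_z_competitor acf mD f0 w10 fw1 Eoo eta0 l1 d0 dw Goo) _.
rewrite -[X in (_ <= X + _ + _)%E]fineK// -!EFinD lee_fin [(t + eta) * w]mulrDl etaw; lra.
Qed.

End Competitor.

(** * Semicontinuity of the convolution and passage to the derivative *)

Section Final.
Context {R : realType}.
Local Notation mu := (@lebesgue_measure R).
Variable z : R -> \bar R.
Hypothesis z_ge0 : forall x : R, 0 <= x -> (0 <= z x)%E.
Hypothesis z_noninc : nonincreasing0 z.
Local Notation G := (convol (g_of z) (@r_ker R)).

(** Isolates the region on which the shifted kernels converge pointwise when [t] is perturbed; at
    [s = t] they may blow up. *)
Lemma convol_itv t : G t = (\int[mu]_(s in `]t, +oo[) (g_of z s * (r_ker (t - s))%:E))%E.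
Proof.
rewrite [RHS]integral_mkcond; apply: eq_integral => s _; rewrite patchE.
case: ifPn => // /negP; rewrite inE/= in_itv/= andbT => /negP; rewrite -leNgt => st.
by rewrite /r_ker subr_lt0 ltNge st/= mule0.
Qed.

Lemma r_ker_cvg (s : nat -> R) (t x : R) : t < x -> s n @[n --> \oo] --> t ->
  r_ker (s n - x) @[n --> \oo] --> r_ker (t - x).
Proof.
move=> tx st.
have -> : r_ker (t - x) = 2 * Num.sqrt 2 / (3 * Num.sqrt (- t - - x)).
  by rewrite /r_ker subr_lt0 tx opprB opprK addrC.
have Nst : - s n @[n --> \oo] --> - t by exact: cvgN.
have Nxt : - x < - t by rewrite ltrN2.
have := cvg_comp _ _ Nst (ker_continuous Nxt); apply: cvg_trans.
apply: near_eq_cvg; near=> n; rewrite /r_ker subr_lt0 opprB opprK.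
have -> : s n < x by near: n; exact: (cvgr_lt t).
by rewrite /= [- s n + x]addrC.
Unshelve. all: by end_near. Qed.

Lemma convol_lsc (t A : R) :
  (forall e, 0 < e -> exists2 s, `|s - t| <= e & (G s <= (A + e)%:E)%E) ->
  (G t <= A%:E)%E.
Proof.
move=> H.
have /choice[s sP] (n : nat) : exists s, `|s - t| <= harmonic n :> R /\
    (G s <= (A + harmonic n)%:E)%E.
  by have [s] := H (harmonic n) (harmonic_gt0 n); exists s.
have st : s n @[n --> \oo] --> t.
  apply/cvgrPdist_le => e e0; have /cvgrPdist_le/(_ e e0) := @cvg_harmonic R.
  apply: filterS => n; rewrite sub0r normrN ger0_norm ?harmonic_ge0//.
  by rewrite distrC; apply: le_trans; have [] := sP n.
pose f n x := (g_of z x * (r_ker (s n - x))%:E)%E.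
have mf n : measurable_fun setT (f n).
  by apply: emeasurable_funM;
    [exact: (measurable_g_of z)|apply/measurable_EFinP; exact: measurable_r_ker].
have f0 n x : (0 <= f n x)%E by rewrite mule_ge0 ?g_of_ge0// lee_fin r_ker_ge0.
rewrite convol_itv.
have -> : (\int[mu]_(x in `]t, +oo[) (g_of z x * (r_ker (t - x))%:E) =
    \int[mu]_(x in `]t, +oo[) limn_einf (f^~ x))%E.
  apply: eq_integral => x; rewrite inE/= in_itv/= andbT => tx.
  apply/esym/(cvg_limn_einf_sup _).1; apply: cvgeM; last 2 first.
  - exact: cvg_cst.
  - by apply: cvg_EFin; [exact: nearW|exact: r_ker_cvg].
  (* A nonzero limit excludes the indeterminate product [+oo * 0] when [g] is infinite at [x]. *)
  - have : r_ker (t - x) != 0.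
      by rewrite /r_ker subr_lt0 tx opprB mulf_neq0// invr_neq0//
         mulf_neq0// sqrtr_eq0 -ltNge subr_gt0.
    by case: (g_of z x).
apply: le_trans (fatou mu _ _ _) _ => //.
  by move=> n; exact: measurable_funS (mf n).
apply/lee_addgt0Pr => e e0; rewrite -EFinD limn_einf_lim.
apply: lime_le; first exact: is_cvg_einfs.
have /cvgrPdist_le/(_ e e0) := @cvg_harmonic R.
apply: filterS => n; rewrite sub0r normrN ger0_norm ?harmonic_ge0// => ne.
apply: (@le_trans _ _ (\int[mu]_(x in `]t, +oo[) f n x)%E).
  by apply: ereal_inf_lbound; exists n => /=.
apply: (@le_trans _ _ (G (s n))).
  exact: (@ge0_subset_integral _ _ _ mu `]t, +oo[ setT (measurable_itv _)
    measurableT _ (mf n) (fun x _ => f0 n x) (@subsetT _ _)).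
by apply: le_trans (sP n).2 _; rewrite lee_fin lerD2l.
Qed.

Lemma tau_z_ge0 w : (0 <= tau_z z w)%E.
Proof.
apply: le_ereal_inf_tmp => _ [psi _ <-]; apply: le_ereal_inf_tmp => _ [dpsi _ <-].
by apply: integral_ge0 => y _; exact: edens_ge0.
Qed.

(* A near-minimiser of mass [w0 + k] comes with a multiplier [s] whose affine function
   [G s + s * w] almost touches the graph of [tau_z] there and lies above it at [w0] and
   [w0 + 2k]; this forces [s] to be close to the derivative. *)
Lemma convol_near_deriv (w0 t e : R) : deriv_at (tau_z z) w0 t -> 0 < e ->
  exists2 s, `|s - t| <= e & (G s <= (fine (tau_z z w0) - t * w0 + e)%:E)%E.
Proof.
move=> [w00 [[r [r0 fin]] dif]] e0.
(* At mass [w0 + k] the value of tau and the choice of the near-minimiser each contribute an error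
   [q * k], and replacing [s] by [t] costs [4 * q * (w0 + k)]. With [k <= 1] the total is at most
   [q * (6 + 4 * w0)]. Working at [w0 + k] also keeps the mass positive when [w0 = 0]. *)
pose q : R := e / (6 + 4 * w0).
have c0 : 0 < 6 + 4 * w0 by lra.
have q0 : 0 < q by rewrite divr_gt0.
have qe : q * (6 + 4 * w0) = e by rewrite divfK// gt_eqF.
have [dl [dl0 dP]] := dif q q0.
pose k : R := Num.min (Num.min (dl / 3) (r / 3)) 1.
have k0 : 0 < k by rewrite !lt_min !divr_gt0//=.
have k1 : k <= 1 by rewrite ge_min lexx orbT.
have kd : k <= dl / 3 by rewrite !ge_min lexx.
have kr : k <= r / 3 by rewrite !ge_min lexx orbT.
have w1 : 0 < w0 + k by lra.
have fin0 : tau_z z w0 \is a fin_num by rewrite -[w0]addr0 fin ?normr0// addr0.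
have fin1 : tau_z z (w0 + k) \is a fin_num by apply: fin; rewrite ?gtr0_norm; lra.
have k20 : 0 < k + k by lra.
have fin2 : tau_z z (w0 + (k + k)) \is a fin_num by apply: fin; rewrite ?gtr0_norm; lra.
have T1 : `|fine (tau_z z (w0 + k)) - fine (tau_z z w0) - t * k| <= q * k.
  have := dP k; rewrite gtr0_norm// => /(_ ltac:(lra) ltac:(lra)).
  rewrite -(ltr_pM2r k0) -[X in _ * X < _](gtr0_norm k0) -normrM mulrBl divfK ?gt_eqF//.
  exact: ltW.
have T2 : `|fine (tau_z z (w0 + (k + k))) - fine (tau_z z w0) - t * (k + k)| <= q * (k + k).
  have := dP (k + k); rewrite gtr0_norm// => /(_ ltac:(lra) ltac:(lra)).
  rewrite -(ltr_pM2r k20) -[X in _ * X < _](gtr0_norm k20) -normrM mulrBl divfK ?gt_eqF//.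
  exact: ltW.
have : (tau_z z (w0 + k) < (fine (tau_z z (w0 + k)) + q * k)%:E)%E.
  by rewrite -{1}(fineK fin1) lte_fin ltrDl mulr_gt0.
move=> /(tau_z_lt z_ge0 z_noninc)[f [D [acf mD f0 fw fE]]].
have Eoo := lt_trans fE (ltry _).
have [s s0] := energy_lower_bound z_ge0 z_noninc acf mD f0 w1 fw Eoo.
move=> /le_lt_trans => /(_ _ fE) Gs.
have G0 := convol_ge0 z s.
have Gfin : G s \is a fin_num.
  rewrite ge0_fin_numE//; apply: le_lt_trans (lt_trans Gs (ltry _)).
  by rewrite leeDl// lee_fin mulr_ge0// ltW.
have tau1 : (tau_z z (w0 + k) < +oo)%E by rewrite -ge0_fin_numE// tau_z_ge0.
have U w : 0 <= w -> tau_z z w \is a fin_num -> fine (tau_z z w) <= fine (G s) + s * w.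
  move=> ww fw1; rewrite -lee_fin EFinD !fineK//.
  exact: (tau_z_upper z_ge0 z_noninc _ w1 tau1 ww).
move: Gs; rewrite -(fineK Gfin) -EFinD lte_fin => /ltW Gs.
have U0 := U _ w00 fin0.
have U2 := U (w0 + (k + k)) ltac:(lra) fin2.
move: T1 T2; rewrite !ler_norml => /andP[T1a T1b] /andP[T2a T2b].
(* Compare the affine bound at [w0] with near-equality at [w0 + k]: the slope [s] exceeds the
   difference quotient by at most [q]. The next bound is the mirror image, using [w0 + 2 k], where
   the errors [q], [q] and [2 * q] add up to [4 * q]. *)
have st1 : s - t <= 2 * q.
  by rewrite -(ler_pM2r k0); lra.
have st2 : t - s <= 4 * q.
  by rewrite -(ler_pM2r k0); lra.
have qw : 0 <= q * w0 by rewrite mulr_ge0// ltW.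
exists s.
  by rewrite ler_norml; apply/andP; split; lra.
rewrite -(fineK Gfin) lee_fin.
have qk : q * k <= q by rewrite ger_pMr.
have sw : (t - s) * w0 <= 4 * q * w0 by rewrite ler_wpM2r.
have sk : (t - s) * k <= 4 * q * k by rewrite ler_wpM2r// ltW.
lra.
Qed.

End Final.

Theorem mainTheorem13 (R : realType) (z : R -> \bar R)
  (z_ge0 : forall x : R, 0 <= x -> (0 <= z x)%E)
  (z_noninc : nonincreasing0 z) (z_lsc : lsc0 z)
  (t : R)
  (ht : exists w : R, 0 <= w /\ deriv_at (tau_z z) w t) :
  conj_tau (tau_z z) t = convol (g_of z) (@r_ker R) t.
Proof.
case: ht => w0 [w00 dw]; have [_ [[r [r0 fin]] _]] := dw.
have fin0 : tau_z z w0 \is a fin_num by rewrite -[w0]addr0 fin ?normr0// addr0.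
(* Differentiability includes finiteness of tau near [w0], and this supplies a positive mass of
   finite energy even when [w0 = 0]. *)
have w1 : 0 < w0 + r / 2 by lra.
have tau1 : (tau_z z (w0 + r / 2) < +oo)%E.
  by rewrite -ge0_fin_numE ?tau_z_ge0// fin ?gtr0_norm; lra.
apply/eqP; rewrite eq_le; apply/andP; split.
  apply: ge_ereal_sup => _ [w ww <-].
  rewrite leeBlDr//; exact: (tau_z_upper z_ge0 z_noninc _ w1 tau1 ww).
(* The single mass [w0] already gives the lower bound for the supremum. *)
apply: (@le_trans _ _ (tau_z z w0 - (t * w0)%:E)%E); last first.
  by apply: ereal_sup_ubound; exists w0.
rewrite -(fineK fin0) -EFinB; apply: convol_lsc => // e e0.
exact: convol_near_deriv.
Qed.
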